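(* Let $a, b \in \mathbb{C}\setminus\{0\}$, $c>0$ and $c>|a|+|b|+2$. If $$\frac{\Gamma(c)\,\Gamma(c-|a|-|b|)}{\Gamma(c-|a|)\,\Gamma(c-|b|)}\Bigg[\frac{2(|a|)_2(|b|)_4}{(c-|a|)_2(c-|a|-|b|-2)_2}\;{}_2F_1(|a|+2,|b|+4;c-|a|+2;-1)$$ $$+\frac{5\,|a|\,(|b|)_2}{(c-|a|)(c-|a|-|b|-1)}\;{}_2F_1(|a|+1,|b|+2;c-|a|+1;-1)+{}_2F_1(|a|,|b|;c-|a|;-1)\Bigg]\le2,$$ then the function $z\,{}_3F_2\left(a,\frac b2,\frac{b+1}2;\frac c2,\frac{c+1}2;z\right)$ belongs to the class $\mathcal{UCV}$.
   Context: $\mathbb{D}=\{z\in\mathbb{C}:|z|<1\}$. $\mathcal{A}$ is the family of analytic functions $f$ on $\mathbb{D}$ of the form $f(z)=z+\sum_{n\ge2}a_nz^n$. $\mathcal{UCV}$ is the class of uniformly convex functions: $f\in\mathcal{A}$ is in $\mathcal{UCV}$ if and only if $\operatorname{Re}\left(1+\frac{(z-\zeta)f''(z)}{f'(z)}\right)>0$ for all $z,\zeta\in\mathbb{D}$. Pochhammer symbol: $(x)_0=1$, $(x)_n=x(x+1)\cdots(x+n-1)$ for $n\ge1$. Clausen's hypergeometric function is ${}_3F_2(a,b,c;d,e;z)=\sum_{n=0}^\infty\frac{(a)_n(b)_n(c)_n}{(d)_n(e)_n(1)_n}z^n$ for $|z|<1$, with $d,e\ne0,-1,-2,\dots$. ${}_2F_1(a,b;c;z)$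 is the Gauss hypergeometric function, i.e. $\sum_{n\ge0}\frac{(a)_n(b)_n}{(c)_n(1)_n}z^n$ for $|z|<1$, continued analytically to $\mathbb{C}\setminus[1,\infty)$ (so its value at $-1$ makes sense). *)

(* Defs.v *)
From Stdlib Require Export Reals.
From Coquelicot Require Export Coquelicot.
Open Scope C_scope.

Definition unit_disc (z : C) : Prop := (Cmod z < 1)%R.

(* The plane cut along [1, +oo). *)
Definition slit_plane (z : C) : Prop := ~ (Im z = 0%R /\ (1 <= Re z)%R).

(* Intended for open [U], as the local expansion is required on a full disc. *)
Definition analytic_on (U : C -> Prop) (f : C -> C) : Prop :=
  forall z0 : C, U z0 ->
    exists (a : nat -> C) (r : R), (0 < r)%R /\
      forall z : C, (Cmod (z - z0) < r)%R -> is_pseries a (z - z0) (f z).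

Definition class_A (f : C -> C) : Prop :=
  analytic_on unit_disc f /\
  exists a : nat -> C, a 0%nat = 0 /\ a 1%nat = 1 /\
    forall z : C, unit_disc z -> is_pseries a z (f z).

(* Division by zero is total, so [f' z <> 0], implicit in the quotient
   [f'' / f'], has to be required separately.  [C_derive] takes the limit along
   the real direction, which is the complex derivative for functions analytic
   on the disc. *)
Definition UCV (f : C -> C) : Prop :=
  class_A f /\
  forall z zeta : C, unit_disc z -> unit_disc zeta ->
    C_derive f z <> 0 /\
    (0 < Re (1 + (z - zeta) * C_derive (C_derive f) z / C_derive f z))%R.

Fixpoint pochhammer (x : C) (n : nat) : C :=
  match n with
  | O => 1
  | S m => pochhammer x m * (x + INR m)
  end.

(* Sum of a complex series; meaningful only when the series converges. *)
Definition CSeries (u : nat -> C) : C :=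
  (Series (fun n => Re (u n)), Series (fun n => Im (u n))).

(* Meaningful for [Cmod z < 1]. *)
Definition hyp3F2 (a b c d e z : C) : C :=
  CSeries (fun n =>
    pochhammer a n * pochhammer b n * pochhammer c n
    / (pochhammer d n * pochhammer e n * pochhammer 1 n) * Cpow z n).

(* [F] is the Gauss function 2F1(a, b; c; .) on the slit plane: the analytic
   continuation of the hypergeometric series. By the identity theorem this
   determines [F] on [slit_plane]; its values on the cut are irrelevant. *)
Definition is_hyp2F1 (a b c : C) (F : C -> C) : Prop :=
  analytic_on slit_plane F /\
  forall z : C, unit_disc z ->
    is_pseries (fun n => pochhammer a n * pochhammer b n
                         / (pochhammer c n * pochhammer 1 n)) z (F z).

(* Euler's integral, convergent for [0 < x]. *)
Definition Gamma (x : R) : R :=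
  RInt_gen (fun t => Rpower t (x - 1) * exp (- t))%R
    (at_right 0) (Rbar_locally p_infty).

(* Main.v *)
(** With [A = |a|] and [B = |b|], the duplication [(b/2)_n ((b+1)/2)_n = (b)_(2n) / 4^n] bounds the
    coefficients of the 3F2 series by [T n = (A)_n (B)_(2n) / ((c)_(2n) n!)], and the function is
    uniformly convex as soon as the sum of [(n+1) (2n+1) T n = (2 n (n-1) + 5 n + 1) T n] is at most 2.
    Each of the three parts is, up to a factor, the sum of [T] for the parameters [(A, B, c)],
    [(A+1, B+2, c+2)] and [(A+2, B+4, c+4)]; so the theorem reduces to
    [sum_n T n = Gamma c Gamma (c-A-B) / (Gamma (c-A) Gamma (c-B)) * 2F1(A, B; c-A; -1)].
    To prove it, let [p_m x] be the Taylor coefficients of [((1 - x t) (1 - t))^(-A)] and sum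
    [(B)_m / (c)_m * p_m x] over [m]. For [|x| < 1] Gauss's theorem, applied to each power of [x], gives
    the Gamma factor times [2F1(A, B; c-A; x)]. At [x = -1] the series is [sum_n T n], since
    [(1 - t^2)^(-A)] is even. A three-term recurrence bounds [p_m x] uniformly in [x] in [[-1, 0]], so
    [x] can tend to [-1] by dominated convergence. *)

Require Import Defs.
From Stdlib Require Import Lra Lia.

Open Scope R_scope.

(** * The Gamma function *)

(** The weight [(n+1) (2n+1)] is [2 n (n+1) + (n+1)]. The part [n+1] controls [f'], whose constant
    term is 1, so that [|f'| >= 2 - sum (n+1) T n]. The part [2 n (n+1)] controls [(z - zeta) f''],
    where [|z - zeta| < 2]. The bound 2 on the total says that the first quantity dominates the
    second.

    The detour through [|x| < 1] is forced. At [x = -1] the double series converges absolutely only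
    when [2 A + B < c], which the hypotheses do not provide, and then the order of summation cannot
    be exchanged directly. Summed over [m] first, the series has a majorant uniform in [x]: the
    Gauss series for [max(A, 1)], [B], [c]. The analytic continuation enters only through its
    continuity at -1.

    The condition [c > A + B + 2] is [A' + B' < c'] for the last parameter triple [(A+2, B+4, c+4)].

    Gauss's theorem rests on the contiguous relation between [C] and [C + 1]. It is iterated towards
    infinity, where two-sided bounds on [Gamma (y + s) / Gamma y] give the limit of the Gamma
    quotient. *)

Lemma ex_series_pos_bounded (a : nat -> R) (M : R) :
  (forall n, 0 <= a n) -> (forall n, sum_n a n <= M) -> ex_series a.
Proof.
  intros Ha HM.
  destruct (ex_finite_lim_seq_incr (sum_n a) M) as [l Hl]; auto.
  - intros n. rewrite sum_Sn. unfold plus; simpl. specialize (Ha (S n)). lra.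
  - exists l. exact Hl.
Qed.

(** The limit is the supremum of the integrals over compact intervals. It is approached because
    enlarging an interval can only increase the integral, and it is positive because the integral
    over [[1, 2]] already is. *)
Lemma is_RInt_gen_pos_bounded (f : R -> R) (M : R) :
  (forall t, 0 < t -> 0 < f t) -> (forall t, 0 < t -> continuous f t) ->
  (forall u v, 0 < u <= v -> RInt f u v <= M) ->
  exists l, 0 < l /\ is_RInt_gen f (at_right 0) (Rbar_locally p_infty) l.
Proof.
  intros Hp Hc HM.
  assert (Hex : forall u v, 0 < u -> 0 < v -> ex_RInt f u v).
  { intros u v Hu Hv. apply (ex_RInt_continuous (V := R_CompleteNormedModule)). intros t Ht. apply Hc.
    destruct Ht as [Ht _]. revert Ht. unfold Rmin. destruct Rle_dec; lra. }
  assert (Hpos : forall u v, 0 < u <= v -> 0 <= RInt f u v).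
  { intros u v Huv. apply RInt_ge_0; try lra. apply Hex; lra.
    intros t Ht. left. apply Hp. lra. }
  assert (Hmono : forall u v u' v', 0 < u' <= u -> u <= v -> v <= v' ->
            RInt f u v <= RInt f u' v').
  { intros u v u' v' H1 H2 H3.
    rewrite <- (RInt_Chasles f u' u v') by (apply Hex; lra).
    rewrite <- (RInt_Chasles f u v v') by (apply Hex; lra).
    unfold plus; simpl.
    pose proof (Hpos u' u ltac:(lra)). pose proof (Hpos v v' ltac:(lra)). lra. }
  destruct (completeness (fun y => exists u v, 0 < u <= v /\ y = RInt f u v)) as [l [Hub Hlub]].
  - exists M. intros y (u & v & Huv & ->). now apply HM.
  - exists (RInt f 1 1). exists 1, 1. split; [lra | easy].
  - exists l. split.
    + apply Rlt_le_trans with (RInt f 1 2).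
      * apply RInt_gt_0; try lra. intros t Ht. apply Hp; lra.
        intros t Ht. apply Hc. lra.
      * apply Hub. exists 1, 2. split; [lra | easy].
    + intros P [eps HP].
      assert (Hy : exists u v, 0 < u <= v /\ l - eps < RInt f u v).
      { destruct (Classical_Prop.classic (exists u v, 0 < u <= v /\ l - eps < RInt f u v)) as [H|H]; auto.
        exfalso. assert (l <= l - eps).
        { apply Hlub. intros y (u & v & Huv & ->). apply Rnot_lt_le. intros Hlt.
          apply H. now exists u, v. }
        pose proof (cond_pos eps). lra. }
      destruct Hy as (u0 & v0 & Huv0 & Hl0).
      assert (Hu0 : 0 < u0) by lra.
      exists (fun u => 0 < u < u0) (fun v => v0 < v).
      * exists (mkposreal u0 Hu0). intros y Hy Hy0. split; auto.
        unfold ball in Hy; simpl in Hy. unfold AbsRing_ball, abs, minus, plus, opp in Hy; simpl in Hy.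
        rewrite Rabs_pos_eq in Hy; lra.
      * now exists v0.
      * intros u v Hu Hv. exists (RInt f u v). split.
        { apply (@RInt_correct R_CompleteNormedModule). apply Hex; simpl; lra. }
        apply HP. unfold ball; simpl. unfold AbsRing_ball, abs, minus, plus, opp; simpl.
        assert (RInt f u v <= l). { apply Hub. exists u, v. split; [lra|easy]. }
        pose proof (Hmono u0 v0 u v ltac:(lra) ltac:(lra) ltac:(lra)).
        apply Rabs_def1; lra.
Qed.

Lemma is_RInt_gen_le_pos (f g : R -> R) (lf lg : R) :
  (forall t, 0 < t -> f t <= g t) ->
  is_RInt_gen f (at_right 0) (Rbar_locally p_infty) lf ->
  is_RInt_gen g (at_right 0) (Rbar_locally p_infty) lg -> lf <= lg.
Proof.
  intros Hfg Hf Hg.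
  pose proof (is_RInt_gen_minus _ _ _ _ Hg Hf) as Hd.
  (* The difference [g - f] serves as its own majorant in [RInt_gen_norm], and a number that bounds
     its own absolute value is nonnegative. *)
  assert (Hd0 : norm (minus lg lf) <= minus lg lf).
  { assert (Hp : filter_prod (at_right 0) (Rbar_locally p_infty) (fun ab : R * R => 0 < fst ab <= snd ab)).
    { exists (fun u => 0 < u < 1) (fun v => 1 < v).
      - exists (mkposreal 1 Rlt_0_1). intros y Hy Hy0. split; auto.
        unfold ball in Hy; simpl in Hy. unfold AbsRing_ball, abs, minus, plus, opp in Hy; simpl in Hy.
        rewrite Rabs_pos_eq in Hy; lra.
      - now exists 1.
      - intros u v Hu Hv; simpl. lra. }
    apply (RInt_gen_norm (V := R_CompleteNormedModule) (Fa := at_right 0) (Fb := Rbar_locally p_infty)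
      (fun y => minus (g y) (f y)) (fun y => minus (g y) (f y))); auto.
    - revert Hp. apply filter_imp. intros; lra.
    - revert Hp. apply filter_imp. intros [u v] Huv x Hx; simpl in *.
      unfold norm; simpl. unfold abs; simpl.
      rewrite Rabs_pos_eq; [lra|]. unfold minus, plus, opp; simpl.
      specialize (Hfg x). lra. }
  unfold norm, minus, plus, opp in Hd0; simpl in Hd0. unfold abs in Hd0; simpl in Hd0.
  pose proof (Rabs_pos (lg + - lf)). lra.
Qed.

Lemma Rpower_pos (x y : R) : 0 < Rpower x y.
Proof. apply exp_pos. Qed.

Lemma Rpower_1_base (y : R) : Rpower 1 y = 1.
Proof. unfold Rpower. now rewrite ln_1, Rmult_0_r, exp_0. Qed.

Lemma Rpower_succ (t x : R) : 0 < t -> Rpower t (x + 1) = t * Rpower t x.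
Proof. intros Ht. rewrite Rpower_plus, Rpower_1 by easy. ring. Qed.

Lemma ln_le_sub_1 (u : R) : 0 < u -> ln u <= u - 1.
Proof.
  intros Hu. pose proof (exp_ineq1_le (ln u)). rewrite exp_ln in H; lra.
Qed.

(** The exponent [1 + p ln p - p] is the maximum of [p ln (1 + t) - t], reached at [1 + t = p]. The
    bound is the inequality [ln u <= u - 1] at [u = (1 + t) / p]. *)
Lemma exp_neg_Rpower_bound (p : R) :
  0 < p -> exists K, 0 < K /\ forall t, 0 < t -> Rpower (1 + t) p * exp (- t) <= K.
Proof.
  intros Hp. exists (exp (1 + p * ln p - p)). split. apply exp_pos.
  intros t Ht. unfold Rpower. rewrite <- exp_plus.
  assert (p * ln (1 + t) + - t <= 1 + p * ln p - p).
  { assert (ln (1 + t) <= (1 + t) / p + ln p - 1).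
    { replace (1 + t) with ((1 + t) / p * p) at 1 by (field; lra).
      assert (0 < (1 + t) / p) by (apply Rdiv_lt_0_compat; lra).
      rewrite ln_mult by easy.
      pose proof (ln_le_sub_1 ((1 + t) / p) ltac:(easy)). lra. }
    apply Rmult_le_compat_l with (r := p) in H; [|lra].
    replace (p * ((1 + t) / p + ln p - 1)) with (1 + t + p * ln p - p) in H by (field; lra). lra. }
  destruct H as [H | ->]; [left; now apply exp_increasing | right; easy].
Qed.

Lemma is_derive_Rpower (x t : R) :
  0 < t -> is_derive (fun s => Rpower s x) t (x * Rpower t (x - 1)).
Proof.
  intros Ht. apply is_derive_Reals. now apply derivable_pt_lim_power.
Qed.

Lemma continuous_Rpower (x t : R) : 0 < t -> continuous (fun s => Rpower s x) t.
Proof.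
  intros Ht. apply (ex_derive_continuous (fun s => Rpower s x)). eexists. now apply is_derive_Rpower.
Qed.

Lemma continuous_gamma_integrand (x t : R) :
  0 < t -> continuous (fun s => Rpower s (x - 1) * exp (- s)) t.
Proof.
  intros Ht. apply (continuous_mult (fun s => Rpower s (x - 1)) (fun s => exp (- s))).
  - now apply continuous_Rpower.
  - apply (ex_derive_continuous (fun s => exp (- s))). auto_derive; auto.
Qed.

(* The integrand is at most a multiple of the derivative of [(t/(1+t))^x], which is bounded. *)
Lemma gamma_integral_bounded (x : R) :
  0 < x -> exists M, forall u v, 0 < u <= v ->
    RInt (fun t => Rpower t (x - 1) * exp (- t)) u v <= M.
Proof.
  intros Hx. destruct (exp_neg_Rpower_bound (x + 1)) as (K & HK & Hb); [lra|].
  exists (K / x). intros u v Huv.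
  set (Psi := fun t => K / x * (Rpower t x * Rpower (1 + t) (- x))).
  set (dPsi := fun t => K * (Rpower t (x - 1) * Rpower (1 + t) (- x - 1))).
  assert (Hd : forall t, 0 < t -> is_derive Psi t (dPsi t)).
  { intros t Ht. unfold Psi, dPsi.
    evar_last.
    { apply is_derive_scal. apply (is_derive_mult (fun t => Rpower t x) (fun t => Rpower (1 + t) (- x))).
      - now apply is_derive_Rpower.
      - apply (is_derive_comp (fun s => Rpower s (- x)) (fun t => 1 + t)).
        apply is_derive_Rpower. lra.
        instantiate (1 := 1). auto_derive; auto.
      - intros; apply Rmult_comm. }
    unfold plus, mult, scal; simpl. unfold mult; simpl.
    replace (Rpower t x) with (t * Rpower t (x - 1)).
    2:{ rewrite <- Rpower_succ by easy. f_equal; ring. }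
    replace (Rpower (1 + t) (- x)) with ((1 + t) * Rpower (1 + t) (- x - 1)).
    2:{ rewrite <- Rpower_succ by lra. f_equal; ring. }
    field. lra. }
  assert (Hcd : forall t, 0 < t -> continuous dPsi t).
  { intros t Ht. unfold dPsi. apply (continuous_scal_r K (fun t => Rpower t (x - 1) * Rpower (1 + t) (- x - 1))).
    apply (continuous_mult (fun t => Rpower t (x - 1)) (fun t => Rpower (1 + t) (- x - 1))).
    - now apply continuous_Rpower.
    - apply (continuous_comp (fun t => 1 + t) (fun s => Rpower s (- x - 1))).
      apply (ex_derive_continuous (fun t => 1 + t)). auto_derive; auto.
      apply continuous_Rpower. lra. }
  assert (Hmin : forall t, Rmin u v <= t <= Rmax u v -> 0 < t).
  { intros t [Ht _]. rewrite Rmin_left in Ht; lra. }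
  assert (HI : is_RInt dPsi u v (minus (Psi v) (Psi u))).
  { apply (is_RInt_derive (V := R_CompleteNormedModule)); intros t Ht; [apply Hd | apply Hcd]; auto. }
  apply Rle_trans with (RInt dPsi u v).
  - apply RInt_le; try lra.
    + apply (ex_RInt_continuous (V := R_CompleteNormedModule)). intros t Ht. apply continuous_gamma_integrand; auto.
    + eexists; apply HI.
    + intros t Ht. unfold dPsi. rewrite <- Rmult_assoc, (Rmult_comm K), Rmult_assoc.
      apply Rmult_le_compat_l. left; apply Rpower_pos.
      replace (- x - 1) with (- (x + 1)) by ring. rewrite Rpower_Ropp.
      pose proof (Rpower_pos (1 + t) (x + 1)).
      apply Rmult_le_reg_l with (Rpower (1 + t) (x + 1)); [easy|].
      replace (Rpower (1 + t) (x + 1) * (K * / Rpower (1 + t) (x + 1))) with K by (field; lra).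
      apply Hb. lra.
  - rewrite (is_RInt_unique _ _ _ _ HI). unfold minus, plus, opp; simpl.
    assert (0 < Psi u).
    { unfold Psi. apply Rmult_lt_0_compat. apply Rdiv_lt_0_compat; lra.
      apply Rmult_lt_0_compat; apply Rpower_pos. }
    assert (Psi v <= K / x).
    { unfold Psi. rewrite <- (Rmult_1_r (K / x)) at 2. apply Rmult_le_compat_l.
      left; apply Rdiv_lt_0_compat; lra.
      rewrite Rpower_Ropp. pose proof (Rpower_pos (1 + v) x).
      apply Rmult_le_reg_r with (Rpower (1 + v) x); [easy|].
      rewrite Rmult_assoc, Rinv_l, Rmult_1_r, Rmult_1_l by lra.
      apply Rle_Rpower_l; lra. }
    lra.
Qed.

(** [RInt_gen] has a value even for a divergent integral; convergence for [0 < x] is what makes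
    [Gamma x] usable as an integral. *)
Lemma Gamma_spec (x : R) : 0 < x ->
  0 < Gamma x /\
  is_RInt_gen (fun t => Rpower t (x - 1) * exp (- t)) (at_right 0) (Rbar_locally p_infty) (Gamma x).
Proof.
  intros Hx. destruct (gamma_integral_bounded x Hx) as [M HM].
  destruct (is_RInt_gen_pos_bounded (fun t => Rpower t (x - 1) * exp (- t)) M) as (l & Hl & HI); auto.
  - intros t Ht. apply Rmult_lt_0_compat. apply Rpower_pos. apply exp_pos.
  - intros t Ht. now apply continuous_gamma_integrand.
  - unfold Gamma. rewrite (is_RInt_gen_unique (V := R_CompleteNormedModule) _ _ HI). auto.
Qed.

Lemma Gamma_pos (x : R) : 0 < x -> 0 < Gamma x.
Proof. intros Hx. now apply Gamma_spec. Qed.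

(** Boundary term at 0 of the integration by parts behind [Gamma_succ]. *)
Lemma filterlim_Rpower_exp_0 (x : R) : 0 < x ->
  filterlim (fun t => - (Rpower t x * exp (- t))) (at_right 0) (locally 0).
Proof.
  intros Hx.
  apply (filterlim_le_le (F := at_right 0) (fun t => - Rpower t x) _ (fun _ => 0) 0).
  - exists (mkposreal 1 Rlt_0_1). intros t _ Ht.
    assert (exp (- t) < 1) by (rewrite <- exp_0; apply exp_increasing; lra).
    pose proof (exp_pos (- t)). pose proof (Rpower_pos t x). nra.
  - intros P [eps HP].
    assert (He : 0 < Rpower eps (/ x)) by apply Rpower_pos.
    exists (mkposreal _ He). intros t Ht Ht0. apply HP.
    unfold ball in Ht |- *; simpl in Ht |- *.
    unfold AbsRing_ball, abs, minus, plus, opp in Ht |- *; simpl in Ht |- *.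
    rewrite Rabs_pos_eq in Ht by lra.
    pose proof (Rpower_pos t x).
    rewrite Rabs_left by lra.
    assert (Rpower t x < Rpower (Rpower eps (/ x)) x) by (apply Rlt_Rpower_l; lra).
    rewrite Rpower_mult, Rinv_l, Rpower_1 in H0 by (try apply cond_pos; lra). lra.
  - apply filterlim_const.
Qed.

(** Boundary term at infinity of the same integration by parts. The exponential bound is taken with
    exponent [x + 1], which leaves a spare factor [1 / t]. *)
Lemma filterlim_Rpower_exp_infty (x : R) : 0 < x ->
  filterlim (fun t => - (Rpower t x * exp (- t))) (Rbar_locally p_infty) (locally 0).
Proof.
  intros Hx. destruct (exp_neg_Rpower_bound (x + 1)) as (K & HK & Hb); [lra|].
  apply (filterlim_le_le (F := Rbar_locally p_infty) (fun t => - (K * / t)) _ (fun _ => 0) 0).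
  - exists 0. intros t Ht. pose proof (Rpower_pos t x). pose proof (exp_pos (- t)).
    split; [|nra]. apply Ropp_le_contravar.
    apply Rmult_le_reg_l with t; [easy|].
    replace (t * (K * / t)) with K by (field; lra).
    eapply Rle_trans; [|apply (Hb t Ht)].
    rewrite <- Rmult_assoc, <- Rpower_succ by easy.
    apply Rmult_le_compat_r; [lra|]. apply Rle_Rpower_l; lra.
  - assert (H : is_lim (fun t => - (K * / t)) p_infty 0).
    { replace (Finite 0) with (Rbar_opp (Rbar_mult K (Rbar_inv p_infty))).
      - apply is_lim_opp. apply is_lim_scal_l. apply is_lim_inv. apply is_lim_id. easy.
      - simpl. apply f_equal. ring. }
    apply H.
  - apply filterlim_const.
Qed.

(** Integration by parts, carried out by evaluating the improper integral of the derivative of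
    [- t^x exp (- t)] twice: by its boundary values, and as a combination of the two Gamma
    integrals. *)
Lemma Gamma_succ (x : R) : 0 < x -> Gamma (x + 1) = x * Gamma x.
Proof.
  intros Hx.
  destruct (Gamma_spec x Hx) as [_ H0]. destruct (Gamma_spec (x + 1) ltac:(lra)) as [_ H1].
  set (f := fun t => - (Rpower t x * exp (- t))).
  assert (Hd : forall t, 0 < t -> is_derive f t (Rpower t (x + 1 - 1) * exp (- t) - x * (Rpower t (x - 1) * exp (- t)))).
  { intros t Ht. unfold f. evar_last.
    { apply (is_derive_opp (fun t => Rpower t x * exp (- t))).
      apply (is_derive_mult (fun t => Rpower t x) (fun t => exp (- t))).
      - now apply is_derive_Rpower.
      - instantiate (1 := - exp (- t)). auto_derive; auto; ring.
      - intros; apply Rmult_comm. }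
    unfold plus, mult, opp; simpl. replace (x + 1 - 1) with x by ring. ring. }
  assert (Hp : filter_prod (at_right 0) (Rbar_locally p_infty)
     (fun ab : R * R => forall t, Rmin (fst ab) (snd ab) <= t <= Rmax (fst ab) (snd ab) -> 0 < t)).
  { exists (fun u => 0 < u) (fun v => 0 < v).
    - exists (mkposreal 1 Rlt_0_1). auto.
    - now exists 0.
    - intros u v Hu Hv t [Ht _]; simpl in *. revert Ht; unfold Rmin; destruct Rle_dec; lra. }
  assert (HD : is_RInt_gen (Derive f) (at_right 0) (Rbar_locally p_infty) (0 - 0)).
  { apply is_RInt_gen_Derive.
    - revert Hp. apply filter_imp. intros ab Hab t Ht. eexists. apply Hd. auto.
    - revert Hp. apply filter_imp. intros ab Hab t Ht.
      specialize (Hab t Ht).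
      apply continuous_ext_loc with (fun t => minus (Rpower t (x + 1 - 1) * exp (- t)) (scal x (Rpower t (x - 1) * exp (- t)))).
      + exists (mkposreal t Hab). intros s Hs. symmetry. apply is_derive_unique.
        apply Hd. unfold ball in Hs; simpl in Hs. unfold AbsRing_ball, abs, minus, plus, opp in Hs; simpl in Hs.
        apply Rabs_def2 in Hs. lra.
      + apply (continuous_minus (fun t => Rpower t (x + 1 - 1) * exp (- t)) (fun t => scal x (Rpower t (x - 1) * exp (- t)))).
        now apply continuous_gamma_integrand.
        apply (continuous_scal_r x (fun t => Rpower t (x - 1) * exp (- t))). now apply continuous_gamma_integrand.
    - now apply filterlim_Rpower_exp_0.
    - now apply filterlim_Rpower_exp_infty. }
  assert (HE : is_RInt_gen (Derive f) (at_right 0) (Rbar_locally p_infty) (Gamma (x + 1) - x * Gamma x)).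
  { apply is_RInt_gen_ext with (fun t => minus (Rpower t (x + 1 - 1) * exp (- t)) (scal x (Rpower t (x - 1) * exp (- t)))).
    - revert Hp. apply filter_imp. intros ab Hab t Ht. symmetry. apply is_derive_unique. apply Hd. apply Hab. lra.
    - apply (is_RInt_gen_minus (V := R_NormedModule)). exact H1.
      apply (is_RInt_gen_scal (V := R_NormedModule)). exact H0. }
  apply (is_RInt_gen_unique (V := R_CompleteNormedModule)) in HD.
  apply (is_RInt_gen_unique (V := R_CompleteNormedModule)) in HE.
  rewrite HD in HE. lra.
Qed.

(* Both bounds integrate the tangent-line inequality [exp u >= 1 + u] for [t ^ s] and
   [t ^ (- s)], at the points [y - 1] and [y + s] where the linear terms cancel. *)
Lemma Gamma_shift_le (y s : R) : 0 < y -> 0 <= s ->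
  Gamma (y + s) <= Rpower (y + s) s * Gamma y.
Proof.
  intros Hy Hs. set (x := y + s). assert (Hx : 0 < x) by (unfold x; lra).
  destruct (Gamma_spec y Hy) as [_ H0]. destruct (Gamma_spec x Hx) as [_ H1].
  destruct (Gamma_spec (x + 1) ltac:(lra)) as [_ H2].
  rewrite (Gamma_succ x Hx) in H2.
  assert (H : (1 + s) * Gamma x - s / x * (x * Gamma x) <= Rpower x s * Gamma y).
  { apply (is_RInt_gen_le_pos
     (fun t => minus (scal (1 + s) (Rpower t (x - 1) * exp (- t))) (scal (s / x) (Rpower t (x + 1 - 1) * exp (- t))))
     (fun t => scal (Rpower x s) (Rpower t (y - 1) * exp (- t)))).
    - intros t Ht. unfold minus, plus, opp, scal; simpl. unfold mult; simpl.
      replace (x + 1 - 1) with (x - 1 + 1) by ring. rewrite Rpower_succ by easy.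
      replace (x - 1) with (y - 1 + s) by (unfold x; ring).
      rewrite Rpower_plus.
      pose proof (exp_pos (- t)). pose proof (Rpower_pos t (y - 1)).
      assert (Hk : (1 + s - s / x * t) * Rpower t s <= Rpower x s).
      { assert (Hu : 0 < t / x) by (apply Rdiv_lt_0_compat; lra).
        assert (Hln : 1 + s - s / x * t <= Rpower (t / x) (- s)).
        { unfold Rpower. pose proof (ln_le_sub_1 _ Hu) as Hl.
          pose proof (exp_ineq1_le (- s * ln (t / x))) as He.
          assert (s * ln (t / x) <= s * (t / x - 1)) by (apply Rmult_le_compat_l; lra).
          replace (s / x * t) with (s * (t / x)) by (field; lra). lra. }
        apply Rle_trans with (Rpower (t / x) (- s) * Rpower t s).
        - apply Rmult_le_compat_r; [left; apply Rpower_pos | easy].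
        - right. rewrite Rpower_Ropp.
          replace (Rpower t s) with (Rpower (t / x) s * Rpower x s).
          + field. pose proof (Rpower_pos (t / x) s). lra.
          + rewrite Rpower_mult_distr by lra. f_equal. field. lra. }
      replace ((1 + s) * (Rpower t (y - 1) * Rpower t s * exp (- t)) +
         - (s / x * (t * (Rpower t (y - 1) * Rpower t s) * exp (- t)))) with
       ((Rpower t (y - 1) * exp (- t)) * ((1 + s - s / x * t) * Rpower t s)) by ring.
      rewrite (Rmult_comm (Rpower x s)). apply Rmult_le_compat_l; [|easy].
      apply Rmult_le_pos; lra.
    - apply (is_RInt_gen_minus (V := R_NormedModule)); apply (is_RInt_gen_scal (V := R_NormedModule)); easy.
    - apply (is_RInt_gen_scal (V := R_NormedModule)); easy. }
  replace (s / x * (x * Gamma x)) with (s * Gamma x) in H by (field; lra). lra.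
Qed.

Lemma Gamma_shift_ge (y s : R) : 1 < y -> 0 <= s ->
  Rpower (y - 1) s * Gamma y <= Gamma (y + s).
Proof.
  intros Hy Hs. set (x := y - 1). assert (Hx : 0 < x) by (unfold x; lra).
  destruct (Gamma_spec x Hx) as [_ H0]. destruct (Gamma_spec y ltac:(lra)) as [_ H1].
  destruct (Gamma_spec (y + s) ltac:(lra)) as [_ H2].
  assert (HG : Gamma y = x * Gamma x).
  { rewrite <- Gamma_succ by easy. f_equal. unfold x; ring. }
  assert (H : Rpower x s * ((1 + s) * Gamma y - s * x * Gamma x) <= Gamma (y + s)).
  { apply (is_RInt_gen_le_pos
     (fun t => scal (Rpower x s) (minus (scal (1 + s) (Rpower t (y - 1) * exp (- t))) (scal (s * x) (Rpower t (x - 1) * exp (- t)))))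
     (fun t => Rpower t (y + s - 1) * exp (- t))); [| |easy].
    - intros t Ht. unfold minus, plus, opp, scal; simpl. unfold mult; simpl.
      replace (y - 1) with (x - 1 + 1) by (unfold x; ring).
      replace (y + s - 1) with (x - 1 + 1 + s) by (unfold x; ring).
      rewrite (Rpower_plus (x - 1 + 1) s), Rpower_succ by easy.
      pose proof (exp_pos (- t)). pose proof (Rpower_pos t (x - 1)).
      assert (Hk : Rpower x s * ((1 + s) * t - s * x) <= t * Rpower t s).
      { assert (Hu : 0 < x / t) by (apply Rdiv_lt_0_compat; lra).
        assert (Hln : 1 + s - s * (x / t) <= Rpower (x / t) (- s)).
        { unfold Rpower. pose proof (ln_le_sub_1 _ Hu) as Hl.
          pose proof (exp_ineq1_le (- s * ln (x / t))) as He.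
          assert (s * ln (x / t) <= s * (x / t - 1)) by (apply Rmult_le_compat_l; lra). lra. }
        replace ((1 + s) * t - s * x) with (t * (1 + s - s * (x / t))) by (field; lra).
        apply Rle_trans with (Rpower x s * (t * Rpower (x / t) (- s))).
        - apply Rmult_le_compat_l; [left; apply Rpower_pos|]. apply Rmult_le_compat_l; lra.
        - right. rewrite Rpower_Ropp.
          replace (Rpower x s) with (Rpower (x / t) s * Rpower t s).
          + field. pose proof (Rpower_pos (x / t) s). lra.
          + rewrite Rpower_mult_distr by lra. f_equal. field. lra. }
      replace (Rpower x s * ((1 + s) * (t * Rpower t (x - 1) * exp (- t)) + - (s * x * (Rpower t (x - 1) * exp (- t)))))
        with ((Rpower t (x - 1) * exp (- t)) * (Rpower x s * ((1 + s) * t - s * x))) by ring.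
      replace (t * Rpower t (x - 1) * Rpower t s * exp (- t)) with ((Rpower t (x - 1) * exp (- t)) * (t * Rpower t s)) by ring.
      apply Rmult_le_compat_l; [|easy].
      apply Rmult_le_pos; lra.
    - apply (is_RInt_gen_scal (V := R_NormedModule)).
      apply (is_RInt_gen_minus (V := R_NormedModule)); apply (is_RInt_gen_scal (V := R_NormedModule)); easy. }
  rewrite HG in H |- *.
  replace (Rpower x s * ((1 + s) * (x * Gamma x) - s * x * Gamma x)) with (Rpower x s * (x * Gamma x)) in H by ring.
  exact H.
Qed.

(** * Gauss's summation theorem *)

Fixpoint rpoch (x : R) (n : nat) : R :=
  match n with
  | O => 1
  | S m => rpoch x m * (x + INR m)
  end.

Lemma rpoch_pos (x : R) (n : nat) : 0 < x -> 0 < rpoch x n.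
Proof.
  intros Hx. induction n as [|n IH]; simpl; [lra|].
  apply Rmult_lt_0_compat; auto. pose proof (pos_INR n). lra.
Qed.

Lemma rpoch_add (x : R) (m n : nat) : rpoch x (m + n) = rpoch x m * rpoch (x + INR m) n.
Proof.
  induction n as [|n IH]; simpl.
  - rewrite Nat.add_0_r. ring.
  - rewrite Nat.add_succ_r. simpl. rewrite IH, plus_INR. ring.
Qed.

Lemma rpoch_succ_l (x : R) (n : nat) : rpoch x (S n) = x * rpoch (x + 1) n.
Proof.
  change (S n) with (1 + n)%nat. rewrite rpoch_add. simpl. rewrite Rplus_0_r. ring.
Qed.

Lemma rpoch_le (x y : R) (n : nat) : 0 < x <= y -> rpoch x n <= rpoch y n.
Proof.
  intros H. induction n as [|n IH]; simpl; [lra|].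
  pose proof (rpoch_pos x n). pose proof (pos_INR n).
  apply Rmult_le_compat; lra.
Qed.

Lemma Gamma_add_nat (x : R) (n : nat) : 0 < x -> Gamma (x + INR n) = rpoch x n * Gamma x.
Proof.
  intros Hx. induction n as [|n IH].
  - simpl. rewrite Rplus_0_r. ring.
  - rewrite S_INR, <- Rplus_assoc, Gamma_succ, IH by (pose proof (pos_INR n); lra). simpl. ring.
Qed.

Lemma ln_INR_unbounded (M : R) : exists n, M < ln (INR n + 1).
Proof.
  destruct (INR_unbounded (exp M)) as [n Hn]. exists n.
  rewrite <- (ln_exp M). apply ln_increasing. apply exp_pos. lra.
Qed.

(* A positive limit would make the series dominate a harmonic one. *)
Lemma ex_series_lim_mul_index (u : nat -> R) (l : R) :
  (forall n, 0 <= u n) -> ex_series u -> is_lim_seq (fun n => INR n * u n) l -> l = 0.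
Proof.
  intros Hu Hex Hl.
  assert (Hl0 : Rbar_le 0 l).
  { apply (is_lim_seq_le (fun _ => 0) (fun n => INR n * u n)); auto using is_lim_seq_const.
    intros n. apply Rmult_le_pos; auto using pos_INR. }
  simpl in Hl0. destruct Hl0 as [Hl0|]; [exfalso|easy].
  apply is_lim_seq_spec in Hl. assert (Hl2 : 0 < l / 2) by lra.
  destruct (Hl (mkposreal _ Hl2)) as [N HN]; simpl in HN.
  (* Past [N] the terms satisfy [1 / k <= 2 / l * u k], and [ln (k + 1) - ln k <= 1 / k] telescopes.
     The logarithm would therefore be bounded by a multiple of the sum. *)
  assert (Hb : forall n, ln (INR n + INR (S N)) - ln (INR (S N)) <= 2 / l * Series u).
  { intros n. apply Rle_trans with (2 / l * (sum_n u (n + N))).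
    - induction n as [|n IH].
      + simpl (INR 0). rewrite Rplus_0_l, Rminus_diag. apply Rmult_le_pos.
        left; apply Rdiv_lt_0_compat; lra.
        rewrite sum_n_Reals. apply cond_pos_sum. auto.
      + rewrite Nat.add_succ_l, sum_Sn.
        match goal with |- _ <= _ * plus ?v ?w => change (plus v w) with (v + w) end.
        specialize (HN (S (n + N)) ltac:(lia)). apply Rabs_def2 in HN. destruct HN as [_ HN].
        assert (Ht : INR n + INR (S N) = INR (S (n + N))).
        { rewrite !S_INR, plus_INR. ring. }
        assert (Ht' : INR (S n) + INR (S N) = INR (S (n + N)) + 1).
        { rewrite !S_INR, plus_INR. ring. }
        rewrite Ht'. rewrite Ht in IH.
        set (k := INR (S (n + N))) in *.
        assert (Hk : 0 < k) by (apply lt_0_INR; lia).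
        assert (Hln : ln (k + 1) - ln k <= / k).
        { replace (k + 1) with (k * (1 + / k)) by (field; lra).
          pose proof (Rinv_0_lt_compat k Hk).
          rewrite ln_mult by lra. pose proof (ln_le_sub_1 (1 + / k)). lra. }
        assert (/ k <= 2 / l * u (S (n + N))).
        { apply Rmult_le_reg_l with (k * l / 2). nra.
          replace (k * l / 2 * / k) with (l / 2) by (field; lra).
          replace (k * l / 2 * (2 / l * u (S (n + N)))) with (k * u (S (n + N))) by (field; lra). lra. }
        lra.
    - apply Rmult_le_compat_l. left; apply Rdiv_lt_0_compat; lra.
      apply (is_lim_seq_incr_compare (sum_n u)).
      + apply (Series_correct u Hex).
      + intros k. rewrite sum_Sn. unfold plus; simpl. specialize (Hu (S k)). lra. }
  destruct (ln_INR_unbounded (2 / l * Series u + ln (INR (S N)))) as [n Hn].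
  specialize (Hb n).
  assert (ln (INR n + 1) <= ln (INR n + INR (S N))).
  { apply ln_le. pose proof (pos_INR n); lra. rewrite S_INR. pose proof (pos_INR N). lra. }
  lra.
Qed.

(** The coefficients of [2F1(A, B; C; x)]; their plain sum is the value at [x = 1]. *)
Definition gauss_term (A B C : R) (n : nat) : R :=
  rpoch A n * rpoch B n / (rpoch C n * rpoch 1 n).

Lemma gauss_term_pos (A B C : R) (n : nat) : 0 < A -> 0 < B -> 0 < C -> 0 < gauss_term A B C n.
Proof.
  intros. unfold gauss_term.
  apply Rdiv_lt_0_compat; apply Rmult_lt_0_compat; apply rpoch_pos; lra.
Qed.

(** Used twice: for large [n] the right-hand side exceeds a fixed multiple of the term, which gives
    convergence; and it turns the contiguous relation into a telescoping sum. *)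
Lemma gauss_term_telescope (A B C : R) (n : nat) : 0 < C ->
  INR n * gauss_term A B C n - INR (S n) * gauss_term A B C (S n)
  = gauss_term A B C n * (INR n * (C - A - B) - A * B) / (C + INR n).
Proof.
  intros HC. unfold gauss_term. cbn [rpoch].
  pose proof (rpoch_pos C n HC). pose proof (rpoch_pos 1 n Rlt_0_1). pose proof (pos_INR n).
  rewrite S_INR. field. repeat split; lra.
Qed.

(** Raabe's test in telescoped form: from some index on, each term is at most [2 / d] times the
    decrease of [n * gauss_term A B C n]. *)
Lemma gauss_term_ex_series (A B C : R) : 0 < A -> 0 < B -> A + B < C ->
  ex_series (gauss_term A B C).
Proof.
  intros HA HB HC. set (d := C - A - B). assert (Hd : 0 < d) by (unfold d; lra).
  (* This [J] ensures [j d - A B >= d / 2 * (C + j)] for all [j >= J]. *)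
  destruct (INR_unbounded ((A * B + d / 2 * C) * 2 / d)) as [J HJ].
  apply (ex_series_incr_n _ J).
  apply ex_series_pos_bounded with (2 / d * (INR J * gauss_term A B C J)).
  - intros n. left. apply gauss_term_pos; lra.
  - intros n.
    assert (H : sum_n (fun k => gauss_term A B C (J + k)) n <=
      2 / d * (INR J * gauss_term A B C J - INR (J + S n) * gauss_term A B C (J + S n))).
    { assert (Hstep : forall k, gauss_term A B C (J + k) <= 2 / d *
         (INR (J + k) * gauss_term A B C (J + k) - INR (J + S k) * gauss_term A B C (J + S k))).
      { intros k. rewrite Nat.add_succ_r, gauss_term_telescope by lra. fold d.
        pose proof (gauss_term_pos A B C (J + k) HA HB ltac:(lra)) as Hg.
        assert (HJk : INR J <= INR (J + k)) by (apply le_INR; lia).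
        set (j := INR (J + k)) in *. pose proof (pos_INR J).
        assert (Hj : d / 2 * (C + j) <= j * d - A * B).
        { apply Rmult_lt_compat_r with (r := d / 2) in HJ; [|lra].
          replace ((A * B + d / 2 * C) * 2 / d * (d / 2)) with (A * B + d / 2 * C) in HJ by (field; lra).
          nra. }
        apply Rmult_le_reg_r with (d / 2 * (C + j)). apply Rmult_lt_0_compat; lra.
        replace (2 / d * (gauss_term A B C (J + k) * (j * d - A * B) / (C + j)) * (d / 2 * (C + j)))
          with (gauss_term A B C (J + k) * (j * d - A * B)) by (field; lra).
        apply Rmult_le_compat_l; lra. }
      induction n as [|n IH].
      - rewrite sum_O. apply (Rle_trans _ _ _ (Hstep 0%nat)). rewrite Nat.add_0_r. lra.
      - rewrite sum_Sn. unfold plus; simpl plus. specialize (Hstep (S n)). simpl. lra. }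
    eapply Rle_trans; [apply H|].
    apply Rmult_le_compat_l. left; apply Rdiv_lt_0_compat; lra.
    pose proof (gauss_term_pos A B C (J + S n) HA HB ltac:(lra)).
    pose proof (pos_INR (J + S n)). nra.
Qed.

(** Term by term, the difference of the two sides is [C] times the decrease of
    [n * gauss_term A B C n], so only the limit of that sequence has to be shown to vanish. *)
Lemma gauss_contiguous (A B C : R) : 0 < A -> 0 < B -> A + B < C ->
  C * (C - A - B) * Series (gauss_term A B C)
  = (C - A) * (C - B) * Series (gauss_term A B (C + 1)).
Proof.
  intros HA HB HC.
  pose proof (gauss_term_ex_series A B C HA HB HC) as E0.
  pose proof (gauss_term_ex_series A B (C + 1) HA HB ltac:(lra)) as E1.
  set (v := fun n => C * (C - A - B) * gauss_term A B C n - (C - A) * (C - B) * gauss_term A B (C + 1) n).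
  assert (Hv : is_series v (C * (C - A - B) * Series (gauss_term A B C)
      - (C - A) * (C - B) * Series (gauss_term A B (C + 1)))).
  { apply (is_series_minus (K := R_AbsRing) (V := R_NormedModule)
       (fun n => C * (C - A - B) * gauss_term A B C n) (fun n => (C - A) * (C - B) * gauss_term A B (C + 1) n));
    apply (is_series_scal (K := R_AbsRing) (V := R_NormedModule)); now apply Series_correct. }
  set (L := C * (C - A - B) * Series (gauss_term A B C)
      - (C - A) * (C - B) * Series (gauss_term A B (C + 1))) in *.
  assert (Hsum : forall n, sum_n v n = - C * (INR (S n) * gauss_term A B C (S n))).
  { assert (Hvn : forall n, v n = C * (INR n * gauss_term A B C n - INR (S n) * gauss_term A B C (S n))).
    { intros n. rewrite gauss_term_telescope by lra. unfold v, gauss_term.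
      replace (rpoch (C + 1) n) with (rpoch C n * (C + INR n) / C).
      2:{ pose proof (rpoch_succ_l C n) as H. simpl in H. rewrite H. field. lra. }
      pose proof (rpoch_pos C n ltac:(lra)). pose proof (rpoch_pos 1 n Rlt_0_1). pose proof (pos_INR n).
      field. repeat split; lra. }
    induction n as [|n IH].
    - rewrite sum_O, Hvn. change (C * (0 * gauss_term A B C 0 - 1 * gauss_term A B C 1) = - C * (1 * gauss_term A B C 1)). ring.
    - rewrite sum_Sn, IH, Hvn. unfold plus; cbn -[INR]. ring. }
  (* The limit exists because [v] is summable. As the limit of [n] times a summable nonnegative
     sequence it is 0, whence [L = 0]. *)
  assert (Hw : is_lim_seq (fun n => INR n * gauss_term A B C n) (- (L / C))).
  { apply is_lim_seq_incr_1.
    apply is_lim_seq_ext with (fun n => - / C * sum_n v n).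
    - intros n. rewrite Hsum. field. lra.
    - replace (- (L / C)) with (- / C * L) by (field; lra).
      exact (is_lim_seq_scal_l (sum_n v) (- / C) L Hv). }
  apply ex_series_lim_mul_index in Hw; auto.
  - assert (L = 0). { replace L with (- - (L / C) * C) by (field; lra). rewrite Hw. ring. }
    unfold L in H. lra.
  - intros n. left. apply gauss_term_pos; lra.
Qed.

Lemma is_lim_seq_div_shift (a b : R) : 0 < b -> is_lim_seq (fun n => (a + INR n) / (b + INR n)) 1.
Proof.
  intros Hb.
  apply is_lim_seq_ext with (fun n => 1 + (a - b) * / (b + INR n)).
  - intros n. pose proof (pos_INR n). field. lra.
  - replace (Finite 1) with (Rbar_plus 1 (Rbar_mult (a - b) (Rbar_inv p_infty))).
    2:{ simpl. f_equal. ring. }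
    eapply is_lim_seq_plus'; [apply is_lim_seq_const|].
    apply (is_lim_seq_scal_l _ (a - b) (Rbar_inv p_infty)).
    apply is_lim_seq_inv; [|easy].
    replace p_infty with (Rbar_plus b p_infty) by easy.
    apply is_lim_seq_plus with b p_infty; [apply is_lim_seq_const | apply is_lim_seq_INR | easy].
Qed.

(** In the terms of index at least 1, the first factor of the denominator grows from [C] to [C + n]
    and the other factors do not decrease. The excess of the series over 1 is thus at most
    [C / (C + n)] times its value for [C]. *)
Lemma gauss_series_lim (A B C : R) : 0 < A -> 0 < B -> A + B < C ->
  is_lim_seq (fun n => Series (gauss_term A B (C + INR n))) 1.
Proof.
  intros HA HB HC.
  set (g := Series (gauss_term A B C)).
  apply is_lim_seq_le_le with (fun _ => 1) (fun n => 1 + C / (C + INR n) * (g - 1)).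
  - intros n. pose proof (pos_INR n) as Hn.
    pose proof (gauss_term_ex_series A B C HA HB HC) as E0.
    pose proof (gauss_term_ex_series A B (C + INR n) HA HB ltac:(lra)) as En.
    assert (H1 : forall C', gauss_term A B C' 0 = 1) by (intros; unfold gauss_term; simpl; field).
    rewrite (Series_incr_1 _ En). unfold g. rewrite (Series_incr_1 _ E0), !H1.
    split.
    + assert (0 <= Series (fun k => gauss_term A B (C + INR n) (S k))); [|lra].
      rewrite <- (Rmult_0_l (Series (fun k => gauss_term A B (C + INR n) (S k)))) at 1.
      rewrite <- Series_scal_l. apply Series_le.
      intros k. pose proof (gauss_term_pos A B (C + INR n) (S k) HA HB ltac:(lra)). lra.
      now apply (ex_series_incr_1 (gauss_term A B (C + INR n))).
    + apply Rplus_le_compat_l.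
      replace (1 + Series (fun k : nat => gauss_term A B C (S k)) - 1)
        with (Series (fun k : nat => gauss_term A B C (S k))) by ring.
      rewrite <- Series_scal_l. apply Series_le.
      * intros k. split. left; apply gauss_term_pos; lra.
        unfold gauss_term. rewrite (rpoch_succ_l C), (rpoch_succ_l (C + INR n)).
        pose proof (rpoch_pos (C + 1) k ltac:(lra)). pose proof (rpoch_pos (C + INR n + 1) k ltac:(lra)).
        pose proof (rpoch_pos A (S k) HA). pose proof (rpoch_pos B (S k) HB). pose proof (rpoch_pos 1 (S k) Rlt_0_1).
        replace (C / (C + INR n) * (rpoch A (S k) * rpoch B (S k) / (C * rpoch (C + 1) k * rpoch 1 (S k))))
         with (rpoch A (S k) * rpoch B (S k) / ((C + INR n) * rpoch 1 (S k)) * / rpoch (C + 1) k) by (field; lra).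
        replace (rpoch A (S k) * rpoch B (S k) / ((C + INR n) * rpoch (C + INR n + 1) k * rpoch 1 (S k)))
         with (rpoch A (S k) * rpoch B (S k) / ((C + INR n) * rpoch 1 (S k)) * / rpoch (C + INR n + 1) k) by (field; lra).
        apply Rmult_le_compat_l.
        left. apply Rdiv_lt_0_compat; apply Rmult_lt_0_compat; lra.
        apply Rinv_le_contravar; [easy|]. apply rpoch_le. lra.
      * apply (ex_series_scal_l (K := R_AbsRing) (V := R_NormedModule)).
        now apply (ex_series_incr_1 (gauss_term A B C)).
  - apply is_lim_seq_const.
  - replace (Finite 1) with (Rbar_plus 1 (Rbar_mult (C * (g - 1)) (Rbar_inv p_infty))).
    2:{ simpl. apply f_equal. ring. }
    apply is_lim_seq_ext with (fun n => 1 + (C * (g - 1)) * / (C + INR n)).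
    { intros n. pose proof (pos_INR n). field. lra. }
    apply is_lim_seq_plus'; [apply is_lim_seq_const|].
    apply (is_lim_seq_scal_l _ (C * (g - 1)) (Rbar_inv p_infty)).
    apply is_lim_seq_inv; [|easy].
    replace p_infty with (Rbar_plus C p_infty) by easy.
    apply is_lim_seq_plus with C p_infty; [apply is_lim_seq_const | apply is_lim_seq_INR | easy].
Qed.

Lemma is_lim_seq_Rpower_1 (u : nat -> R) (b : R) :
  is_lim_seq u 1 -> is_lim_seq (fun n => Rpower (u n) b) 1.
Proof.
  intros Hu. rewrite <- (Rpower_1_base b).
  apply (is_lim_seq_continuous (fun s => Rpower s b) u 1); [|easy].
  apply continuity_pt_filterlim. apply continuous_Rpower. lra.
Qed.

(** With [Y = C + n - A - B], the quotient is [Gamma (Y + B) / Gamma Y] divided by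
    [Gamma (Y + A + B) / Gamma (Y + A)]. Both are shifts by the same [B], so their growth cancels
    between the upper and lower shift bounds. *)
Lemma Gamma_ratio_lim (A B C : R) : 0 < A -> 0 < B -> A + B < C ->
  is_lim_seq (fun n => Gamma (C + INR n - A) * Gamma (C + INR n - B)
                 / (Gamma (C + INR n) * Gamma (C + INR n - A - B))) 1.
Proof.
  intros HA HB HC. set (D := C - A - B).
  (* The index shifts give [Y > 2], so that [Gamma_shift_ge], which asks for an argument above 1,
     applies. *)
  apply is_lim_seq_incr_1. apply is_lim_seq_incr_1.
  apply is_lim_seq_le_le with
    (fun n => Rpower ((D + 1 + INR n) / (C + 2 + INR n)) B)
    (fun n => Rpower ((D + 2 + B + INR n) / (D + 1 + A + INR n)) B).
  - intros n. rewrite !S_INR. pose proof (pos_INR n) as Hn.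
    set (Y := D + 2 + INR n). assert (HY : 2 < Y) by (unfold Y, D; lra).
    replace (C + (INR n + 1 + 1) - A) with (Y + B) by (unfold Y, D; ring).
    replace (C + (INR n + 1 + 1) - B) with (Y + A) by (unfold Y, D; ring).
    replace (C + (INR n + 1 + 1)) with (Y + A + B) by (unfold Y, D; ring).
    replace (Y + B - B) with Y by ring.
    replace (D + 1 + INR n) with (Y - 1) by (unfold Y; ring).
    replace (C + 2 + INR n) with (Y + A + B) by (unfold Y, D; ring).
    replace (D + 2 + B + INR n) with (Y + B) by (unfold Y; ring).
    replace (D + 1 + A + INR n) with (Y + A - 1) by (unfold Y; ring).
    pose proof (Gamma_shift_le Y B ltac:(lra) ltac:(lra)).
    pose proof (Gamma_shift_ge Y B ltac:(lra) ltac:(lra)).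
    pose proof (Gamma_shift_le (Y + A) B ltac:(lra) ltac:(lra)).
    pose proof (Gamma_shift_ge (Y + A) B ltac:(lra) ltac:(lra)).
    pose proof (Gamma_pos Y ltac:(lra)). pose proof (Gamma_pos (Y + A) ltac:(lra)).
    pose proof (Gamma_pos (Y + B) ltac:(lra)). pose proof (Gamma_pos (Y + A + B) ltac:(lra)).
    assert (Hdiv : forall s t, 0 < s -> 0 < t -> Rpower (s / t) B = Rpower s B / Rpower t B).
    { intros s t Hs Ht. pose proof (Rpower_pos t B).
      apply Rmult_eq_reg_r with (Rpower t B); [|lra].
      assert (0 < s / t) by (apply Rdiv_lt_0_compat; lra).
      rewrite Rpower_mult_distr by easy. replace (s / t * t) with s by (field; lra). field. lra. }
    rewrite !Hdiv by lra.
    pose proof (Rpower_pos (Y - 1) B). pose proof (Rpower_pos (Y + A + B) B).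
    pose proof (Rpower_pos (Y + B) B). pose proof (Rpower_pos (Y + A - 1) B).
    replace (Gamma (Y + B) * Gamma (Y + A) / (Gamma (Y + A + B) * Gamma Y))
      with ((Gamma (Y + B) / Gamma Y) * (Gamma (Y + A) / Gamma (Y + A + B))) by (field; lra).
    unfold Rdiv. split; apply Rmult_le_compat.
    + lra.
    + left; now apply Rinv_0_lt_compat.
    + apply Rmult_le_reg_r with (Gamma Y); [easy|].
      replace (Gamma (Y + B) * / Gamma Y * Gamma Y) with (Gamma (Y + B)) by (field; lra). lra.
    + apply Rmult_le_reg_r with (Rpower (Y + A + B) B * Gamma (Y + A + B)).
      apply Rmult_lt_0_compat; lra.
      replace (/ Rpower (Y + A + B) B * (Rpower (Y + A + B) B * Gamma (Y + A + B))) with (Gamma (Y + A + B)) by (field; lra).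
      replace (Gamma (Y + A) * / Gamma (Y + A + B) * (Rpower (Y + A + B) B * Gamma (Y + A + B))) with
       (Rpower (Y + A + B) B * Gamma (Y + A)) by (field; lra). lra.
    + left. apply Rdiv_lt_0_compat; lra.
    + left. apply Rdiv_lt_0_compat; lra.
    + apply Rmult_le_reg_r with (Gamma Y); [easy|].
      replace (Gamma (Y + B) * / Gamma Y * Gamma Y) with (Gamma (Y + B)) by (field; lra). lra.
    + apply Rmult_le_reg_r with (Rpower (Y + A - 1) B * Gamma (Y + A + B)).
      apply Rmult_lt_0_compat; lra.
      replace (/ Rpower (Y + A - 1) B * (Rpower (Y + A - 1) B * Gamma (Y + A + B))) with (Gamma (Y + A + B)) by (field; lra).
      replace (Gamma (Y + A) * / Gamma (Y + A + B) * (Rpower (Y + A - 1) B * Gamma (Y + A + B))) with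
       (Rpower (Y + A - 1) B * Gamma (Y + A)) by (field; lra). lra.
  - apply is_lim_seq_Rpower_1. apply is_lim_seq_div_shift. lra.
  - apply is_lim_seq_Rpower_1. apply is_lim_seq_div_shift. unfold D; lra.
Qed.

(** The product of the series and the inverse Gamma quotient [G] is invariant under [C -> C + 1], by
    the contiguous relation and [Gamma_succ]. Along [C + n] both factors tend to 1, so the product
    is 1. *)
Theorem gauss_summation (A B C : R) : 0 < A -> 0 < B -> A + B < C ->
  Series (gauss_term A B C) = Gamma C * Gamma (C - A - B) / (Gamma (C - A) * Gamma (C - B)).
Proof.
  intros HA HB HC.
  set (G := fun C => Gamma (C - A) * Gamma (C - B) / (Gamma C * Gamma (C - A - B))).
  assert (Hstep : forall n, Series (gauss_term A B (C + INR n)) * G (C + INR n) = Series (gauss_term A B C) * G C).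
  { induction n as [|n IH].
    - simpl. now rewrite Rplus_0_r.
    - rewrite <- IH. rewrite S_INR. pose proof (pos_INR n).
      set (E := C + INR n). replace (C + (INR n + 1)) with (E + 1) by (unfold E; ring).
      assert (HE : A + B < E) by (unfold E; lra). clearbody E.
      pose proof (gauss_contiguous A B E HA HB HE) as Hc. unfold G.
      replace (E + 1 - A) with (E - A + 1) by ring.
      replace (E + 1 - B) with (E - B + 1) by ring.
      replace (E - A + 1 - B) with (E - A - B + 1) by ring.
      rewrite !Gamma_succ by lra.
      pose proof (Gamma_pos E ltac:(lra)). pose proof (Gamma_pos (E - A - B) ltac:(lra)).
      replace (Series (gauss_term A B E)) with
         ((E - A) * (E - B) * Series (gauss_term A B (E + 1)) / (E * (E - A - B))).
      2:{ rewrite <- Hc. field. lra. }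
      field. repeat split; lra. }
  assert (Hlim : is_lim_seq (fun n => Series (gauss_term A B (C + INR n)) * G (C + INR n)) (1 * 1)).
  { apply is_lim_seq_mult'. now apply gauss_series_lim. exact (Gamma_ratio_lim A B C HA HB HC). }
  apply is_lim_seq_ext with (v := fun _ => Series (gauss_term A B C) * G C) in Hlim; [|easy].
  apply is_lim_seq_unique in Hlim. rewrite Lim_seq_const in Hlim. injection Hlim; intros H.
  unfold G in H.
  pose proof (Gamma_pos C ltac:(lra)). pose proof (Gamma_pos (C - A - B) ltac:(lra)).
  pose proof (Gamma_pos (C - A) ltac:(lra)). pose proof (Gamma_pos (C - B) ltac:(lra)).
  apply Rmult_eq_reg_r with (Gamma (C - A) * Gamma (C - B) / (Gamma C * Gamma (C - A - B))).
  - rewrite H. field. lra.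
  - apply Rgt_not_eq. apply Rdiv_lt_0_compat; apply Rmult_lt_0_compat; lra.
Qed.

(** * Summation of the majorant *)

(** The error estimate of the Weierstrass test. The setting of normed modules covers both the real
    series of [tannery] and the complex power series. *)
Lemma is_series_tail_norm {K : AbsRing} {V : NormedModule K}
    (a : nat -> V) (l : V) (M : nat -> R) (L : R) (N : nat) :
  is_series a l -> (forall n, norm (a n) <= M n) -> is_series M L ->
  norm (minus l (sum_n a N)) <= L - sum_n M N.
Proof.
  intros Ha HM HL.
  assert (Hfin : forall n, norm (minus (sum_n a (n + N)) (sum_n a N)) <= sum_n M (n + N) - sum_n M N).
  { induction n as [|n IH].
    - change (0 + N)%nat with N. rewrite (minus_eq_zero (G := V)).
      eapply Rle_trans; [apply Req_le; apply (norm_zero (V := V))|lra].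
    - simpl. rewrite !sum_Sn. unfold plus at 2; simpl.
      apply Rle_trans with (norm (plus (minus (sum_n a (n + N)) (sum_n a N)) (a (S (n + N))))).
      + right. f_equal. unfold minus. rewrite <- !plus_assoc. f_equal. apply plus_comm.
      + eapply Rle_trans; [apply norm_triangle|]. specialize (HM (S (n + N))). lra. }
  assert (Hl : filterlim (fun n => norm (minus (sum_n a (n + N)) (sum_n a N))) eventually
     (Rbar_locally (norm (minus l (sum_n a N))))).
  { apply (filterlim_comp _ _ _ (fun n => minus (sum_n a (n + N)) (sum_n a N)) norm _ (locally (minus l (sum_n a N)))).
    - unfold minus. eapply filterlim_comp_2; [|apply filterlim_const|apply filterlim_plus].
      intros P HP. destruct (Ha P HP) as [n0 H0]. exists n0. intros n Hn. apply H0. lia.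
    - apply filterlim_norm. }
  assert (Hr : is_lim_seq (fun n => sum_n M (n + N) - sum_n M N) (L - sum_n M N)).
  { apply is_lim_seq_minus'; [|apply is_lim_seq_const]. now apply (is_lim_seq_incr_n (sum_n M) N). }
  exact (is_lim_seq_le _ _ _ _ Hfin Hl Hr).
Qed.

Lemma is_series_norm_le {K : AbsRing} {V : NormedModule K}
    (a : nat -> V) (l : V) (M : nat -> R) (L : R) :
  is_series a l -> (forall n, norm (a n) <= M n) -> is_series M L -> norm l <= L.
Proof.
  intros Ha HM HL. pose proof (is_series_tail_norm a l M L 0 Ha HM HL) as H.
  rewrite !sum_O in H. specialize (HM 0%nat).
  replace l with (plus (minus l (a 0%nat)) (a 0%nat)).
  - eapply Rle_trans; [apply norm_triangle|]. lra.
  - unfold minus. now rewrite <- plus_assoc, plus_opp_l, plus_zero_r.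
Qed.

Lemma is_lim_seq_sum_n (u : nat -> nat -> R) (v : nat -> R) (N : nat) :
  (forall k, is_lim_seq (fun n => u n k) (v k)) ->
  is_lim_seq (fun n => sum_n (u n) N) (sum_n v N).
Proof.
  intros H. induction N as [|N IH].
  - rewrite sum_O. apply is_lim_seq_ext with (fun n => u n 0%nat); auto.
    intros n. now rewrite sum_O.
  - rewrite sum_Sn. apply is_lim_seq_ext with (fun n => sum_n (u n) N + u n (S N)).
    + intros n. now rewrite sum_Sn.
    + now apply is_lim_seq_plus'.
Qed.

(** Dominated convergence for series: [N] makes the tail of [M] smaller than [eps / 4], which
    handles both remainders, and the first terms converge as a finite sum. *)
Lemma tannery (u : nat -> nat -> R) (v M : nat -> R) :
  (forall n k, Rabs (u n k) <= M k) -> ex_series M ->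
  (forall k, is_lim_seq (fun n => u n k) (v k)) ->
  is_lim_seq (fun n => Series (u n)) (Series v).
Proof.
  intros Hu HM Huv.
  assert (Hv : forall k, Rabs (v k) <= M k).
  { intros k. apply (is_lim_seq_le (fun n => Rabs (u n k)) (fun _ => M k) (Rabs (v k)) (M k)); auto.
    apply (is_lim_seq_abs _ _ (Huv k)). apply is_lim_seq_const. }
  assert (Hex : forall w : nat -> R, (forall k, Rabs (w k) <= M k) -> is_series w (Series w)).
  { intros w Hw. apply Series_correct.
    now apply (ex_series_le (V := R_CompleteNormedModule) w M). }
  pose proof (Series_correct M HM) as HL.
  apply is_lim_seq_spec. intros eps.
  assert (He : 0 < eps / 4) by (pose proof (cond_pos eps); lra).
  pose proof (proj2 (is_lim_seq_spec (sum_n M) (Series M)) HL (mkposreal _ He)) as [N HN].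
  specialize (HN N (le_n N)). simpl in HN.
  pose proof (proj2 (is_lim_seq_spec _ _) (is_lim_seq_sum_n u v N Huv) (mkposreal _ He)) as [n0 Hn0].
  exists n0. intros n Hn. specialize (Hn0 n Hn). simpl in Hn0.
  assert (Htail : forall a : nat -> R, (forall k, Rabs (a k) <= M k) ->
            Rabs (Series a - sum_n a N) <= Series M - sum_n M N).
  { intros a Ha. exact (is_series_tail_norm (V := R_NormedModule) a _ M _ N (Hex a Ha) Ha HL). }
  pose proof (Htail _ (Hu n)) as T1. pose proof (Htail _ Hv) as T2.
  apply Rabs_def2 in HN. apply Rabs_def2 in Hn0.
  apply Rabs_le_between in T1. apply Rabs_le_between in T2.
  apply Rabs_def1; lra.
Qed.

(** Presents a finite sum as a series, so that the partial sums of a double series come within reach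
    of [tannery]. *)
Lemma is_series_truncate (g : nat -> R) (N : nat) :
  is_series (fun k => if (k <=? N)%nat then g k else 0) (sum_n g N).
Proof.
  assert (H : forall n, sum_n (fun k => if (k <=? N)%nat then g k else 0) (n + N) = sum_n g N).
  { induction n as [|n IH].
    - apply sum_n_ext_loc. intros k Hk. now rewrite (proj2 (Nat.leb_le k N)) by easy.
    - change (S n + N)%nat with (S (n + N)). rewrite sum_Sn, IH. rewrite (proj2 (Nat.leb_gt (S (n + N)) N)) by lia. apply Rplus_0_r. }
  apply (proj2 (is_lim_seq_incr_n (sum_n (fun k => if (k <=? N)%nat then g k else 0)) N (sum_n g N))).
  apply is_lim_seq_ext with (fun _ => sum_n g N); auto using is_lim_seq_const.
Qed.

(** The triangle [k + j <= N] is summed by diagonals on the left and by rows on the right; in the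
    induction a new diagonal adds one entry to each row and opens a row of length one. *)
Lemma sum_n_triangle (f : nat -> nat -> R) (N : nat) :
  sum_n (fun m => sum_n (fun k => f k (m - k)%nat) m) N = sum_n (fun k => sum_n (f k) (N - k)) N.
Proof.
  induction N as [|N IH].
  - now rewrite !sum_O.
  - rewrite !sum_Sn, IH. rewrite Nat.sub_diag, sum_O.
    rewrite (sum_n_ext_loc (fun k => sum_n (f k) (S N - k))
      (fun k => plus (sum_n (f k) (N - k)) (f k (S N - k)%nat))).
    + rewrite (sum_n_plus (G := R_AbelianMonoid)). apply (plus_assoc (G := R_AbelianMonoid)).
    + intros k Hk. replace (S N - k)%nat with (S (N - k)) by lia. now rewrite sum_Sn.
Qed.

Lemma sum_n_succ_l (a : nat -> R) (n : nat) : sum_n a (S n) = a 0%nat + sum_n (fun k => a (S k)) n.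
Proof.
  induction n as [|n IH].
  - now rewrite sum_Sn, !sum_O.
  - rewrite sum_Sn, IH, sum_Sn. unfold plus; simpl. ring.
Qed.

Lemma sum_n_Rmult_l (c : R) (a : nat -> R) (n : nat) : sum_n (fun k => c * a k) n = c * sum_n a n.
Proof. apply (sum_n_mult_l (K := R_Ring)). Qed.

Lemma sum_n_Rplus (a b : nat -> R) (n : nat) : sum_n (fun k => a k + b k) n = sum_n a n + sum_n b n.
Proof. apply (sum_n_plus (G := R_AbelianMonoid)). Qed.

Lemma sum_n_R_ext (a b : nat -> R) (n : nat) :
  (forall k, (k <= n)%nat -> a k = b k) -> sum_n a n = sum_n b n.
Proof. apply (sum_n_ext_loc (G := R_AbelianMonoid)). Qed.

(* The Taylor coefficients of [(1 - t) ^ (- A)]. *)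
Definition neg_binom (A : R) (n : nat) : R := rpoch A n / rpoch 1 n.

(* The Taylor coefficients of [((1 - x t) (1 - t)) ^ (- A)]. *)
Definition neg_binom2 (A x : R) (m : nat) : R :=
  sum_n (fun k => x ^ k * neg_binom A k * neg_binom A (m - k)) m.

Lemma neg_binom_pos (A : R) (n : nat) : 0 < A -> 0 < neg_binom A n.
Proof. intros HA. apply Rdiv_lt_0_compat; apply rpoch_pos; lra. Qed.

Lemma neg_binom_0 (A : R) : neg_binom A 0 = 1.
Proof. unfold neg_binom. simpl. field. Qed.

Lemma neg_binom_succ (A : R) (n : nat) :
  INR (S n) * neg_binom A (S n) = (A + INR n) * neg_binom A n.
Proof.
  unfold neg_binom. cbn [rpoch]. pose proof (rpoch_pos 1 n Rlt_0_1). pose proof (pos_INR n).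
  rewrite S_INR. field. lra.
Qed.

Lemma neg_binom2_0 (A x : R) : neg_binom2 A x 0 = 1.
Proof. unfold neg_binom2. rewrite sum_O. simpl. rewrite neg_binom_0. ring. Qed.

Lemma neg_binom2_1 (A x : R) : neg_binom2 A x 1 = (1 + x) * A.
Proof. unfold neg_binom2. rewrite sum_Sn, sum_O. unfold plus, neg_binom; simpl. field. Qed.

(** Coefficient form of the differential equation [(1 - x t) (1 - t) p' = A (1 + x - 2 x t) p]
    satisfied by [p = ((1 - x t) (1 - t))^(-A)]. *)
Lemma neg_binom2_succ (A x : R) (m : nat) :
  INR (S (S m)) * neg_binom2 A x (S (S m))
  = (1 + x) * (INR (S m) + A) * neg_binom2 A x (S m) - x * (INR m + 2 * A) * neg_binom2 A x m.
Proof.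
  set (p := neg_binom2 A x). set (al := neg_binom A).
  (* [D] and [E] are the coefficients of [t p'] split by the product rule: the derivative falls on
     [(1 - x t)^(-A)] in [D] and on [(1 - t)^(-A)] in [E]. *)
  set (D := fun m => sum_n (fun k => INR k * (x ^ k * al k * al (m - k)%nat)) m).
  set (E := fun m => sum_n (fun k => INR (m - k) * (x ^ k * al k * al (m - k)%nat)) m).
  assert (HDE : forall m, INR m * p m = D m + E m).
  { intros n. unfold D, E, p, neg_binom2. rewrite <- sum_n_Rplus, <- sum_n_Rmult_l.
    apply sum_n_R_ext. intros k Hk. fold al.
    rewrite minus_INR by easy. ring. }
  assert (HD : forall m, D (S m) = x * (A * p m + D m)).
  { intros n. unfold D at 1. rewrite sum_n_succ_l. simpl (INR 0). rewrite Rmult_0_l, Rplus_0_l.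
    unfold p, neg_binom2, D. rewrite <- sum_n_Rmult_l, <- sum_n_Rplus, <- sum_n_Rmult_l.
    apply sum_n_R_ext. intros k Hk. fold al.
    replace (S n - S k)%nat with (n - k)%nat by lia.
    transitivity (x * x ^ k * (INR (S k) * al (S k)) * al (n - k)%nat); [simpl (x ^ S k); ring|].
    unfold al at 1. rewrite neg_binom_succ. fold al. ring. }
  assert (HE : forall m, E (S m) = A * p m + E m).
  { intros n. unfold E at 1. rewrite sum_Sn, Nat.sub_diag. simpl (INR 0).
    rewrite Rmult_0_l. rewrite (plus_zero_r (G := R_AbelianGroup)).
    unfold p, neg_binom2, E. rewrite <- sum_n_Rmult_l, <- sum_n_Rplus.
    apply sum_n_R_ext. intros k Hk. fold al.
    replace (S n - k)%nat with (S (n - k)) by lia.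
    transitivity (x ^ k * al k * (INR (S (n - k)) * al (S (n - k)))); [ring|].
    unfold al at 2. rewrite neg_binom_succ. fold al. ring. }
  rewrite HDE, HD, HE.
  pose proof (HDE (S m)) as H1. pose proof (HDE m) as H0. pose proof (HD m) as HDm. pose proof (HE m) as HEm.
  replace (x * (A * p (S m) + D (S m)) + (A * p (S m) + E (S m)))
    with ((1 + x) * A * p (S m) + (1 + x) * (D (S m) + E (S m)) - (D (S m) + x * E (S m))) by ring.
  rewrite <- H1, HDm, HEm.
  replace (x * (A * p m + D m) + x * (A * p m + E m)) with (x * (2 * A * p m + (D m + E m))) by ring.
  rewrite <- H0. ring.
Qed.

(* The majorant satisfies the recurrence as an inequality because [Q ^ 2 >= Q]. *)
Lemma neg_binom2_bound (A Q x : R) (m : nat) :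
  0 < A <= Q -> 1 <= Q -> -1 <= x <= 0 ->
  0 <= neg_binom2 A x m <= neg_binom Q m.
Proof.
  intros HA HQ Hx.
  enough (H : 0 <= neg_binom2 A x m <= neg_binom Q m /\ 0 <= neg_binom2 A x (S m) <= neg_binom Q (S m)) by apply H.
  induction m as [|m [[IH0 IH1] [IH2 IH3]]].
  - rewrite neg_binom2_0, neg_binom2_1, neg_binom_0.
    replace (neg_binom Q 1) with Q by (unfold neg_binom; simpl; field). split; split; nra.
  - split; [easy|].
    pose proof (neg_binom2_succ A x m) as Hrec.
    pose proof (neg_binom_succ Q (S m)) as HQ2. pose proof (neg_binom_succ Q m) as HQ1.
    rewrite !S_INR in *. pose proof (pos_INR m) as Hm.
    set (n := INR m) in *. set (p2 := neg_binom2 A x (S (S m))) in *. set (p1 := neg_binom2 A x (S m)) in *.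
    set (p0 := neg_binom2 A x m) in *.
    set (q2 := neg_binom Q (S (S m))) in *. set (q1 := neg_binom Q (S m)) in *.
    set (q0 := neg_binom Q m) in *.
    assert (Hq0 : 0 < q0) by (apply neg_binom_pos; lra).
    assert (Hq : (n + 2 * Q) * q0 <= (n + 1 + Q) * q1).
    { apply Rmult_le_reg_l with (n + 1); [lra|].
      replace ((n + 1) * ((n + 1 + Q) * q1)) with ((n + 1 + Q) * ((n + 1) * q1)) by ring.
      rewrite HQ1. assert (0 <= (Q * Q - Q) * q0) by (apply Rmult_le_pos; nra). lra. }
    (* For [x] in [[-1, 0]] the weights [1 + x] and [- x] are nonnegative with sum 1. Both terms are
       bounded by their weight times [(n + 1 + Q) * q1], which is [(n + 2) * q2]. *)
    assert (H1 : 0 <= (1 + x) * (n + 1 + A) * p1 <= (1 + x) * ((n + 1 + Q) * q1)).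
    { split. apply Rmult_le_pos; [|easy]. apply Rmult_le_pos; lra.
      rewrite Rmult_assoc. apply Rmult_le_compat_l; [lra|]. apply Rmult_le_compat; lra. }
    assert (H0 : 0 <= (- x) * ((n + 2 * A) * p0) <= (- x) * ((n + 1 + Q) * q1)).
    { split. apply Rmult_le_pos; [lra|]. apply Rmult_le_pos; lra.
      apply Rmult_le_compat_l; [lra|]. apply Rle_trans with ((n + 2 * Q) * q0); [|easy].
      apply Rmult_le_compat; lra. }
    split; apply Rmult_le_reg_l with (n + 1 + 1); lra.
Qed.

(** At [x = -1] the factor [1 + x] removes the middle term of the recurrence, which then separates
    the parities; its even half is the recurrence of [neg_binom]. *)
Lemma neg_binom2_m1 (A : R) (n : nat) :
  neg_binom2 A (-1) (2 * n) = neg_binom A n /\ neg_binom2 A (-1) (2 * n + 1) = 0.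
Proof.
  induction n as [|n [IH0 IH1]].
  - simpl. rewrite neg_binom2_0, neg_binom2_1, neg_binom_0. split; ring.
  - pose proof (neg_binom2_succ A (-1) (2 * n)) as H0.
    pose proof (neg_binom2_succ A (-1) (2 * n + 1)) as H1.
    replace (2 * S n)%nat with (S (S (2 * n))) by lia.
    replace (S (S (2 * n)) + 1)%nat with (S (S (2 * n + 1))) by lia.
    replace (S (2 * n)) with (2 * n + 1)%nat in * by lia.
    rewrite IH1 in H0, H1. rewrite IH0 in H0.
    split.
    + pose proof (neg_binom_succ A n) as Hs.
      apply Rmult_eq_reg_l with (INR (S (2 * n + 1))).
      2: now apply not_0_INR.
      rewrite H0.
      replace (INR (S (2 * n + 1))) with (2 * INR (S n)) by (rewrite !S_INR, plus_INR, mult_INR; simpl; ring).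
      replace (INR (2 * n)) with (2 * INR n) by (rewrite mult_INR; simpl; ring).
      rewrite (Rmult_assoc 2 (INR (S n))).
      rewrite Hs. ring.
    + apply Rmult_eq_reg_l with (INR (S (S (2 * n + 1)))).
      2: now apply not_0_INR.
      rewrite H1. ring.
Qed.

(** By Gauss's theorem, the value of [2F1(A, B; c; 1)] when [A + B < c]. *)
Definition gamma_factor (A B c : R) : R :=
  Gamma c * Gamma (c - A - B) / (Gamma (c - A) * Gamma (c - B)).

(** Up to the factor [(B)_k / (c)_k] this is Gauss's sum for [B + k] and [c + k]. The differences
    [c - B] and [c - A - B] are unaffected by [k], and [Gamma (c + k - A)] leaves [(c - A)_k] below:
    this is the origin of the third parameter [c - A]. *)
Lemma shifted_gauss_series (A B c : R) (k : nat) : 0 < A -> 0 < B -> A + B < c ->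
  is_series (fun j => neg_binom A j * (rpoch B (k + j) / rpoch c (k + j)))
    (gamma_factor A B c * (rpoch B k / rpoch (c - A) k)).
Proof.
  intros HA HB Hc. pose proof (pos_INR k) as Hk.
  pose proof (Series_correct _ (gauss_term_ex_series A (B + INR k) (c + INR k) HA ltac:(lra) ltac:(lra))) as H.
  rewrite gauss_summation in H by lra.
  apply (is_series_scal (K := R_AbsRing) (V := R_NormedModule) (rpoch B k / rpoch c k)) in H.
  pose proof (rpoch_pos c k ltac:(lra)). pose proof (rpoch_pos (c - A) k ltac:(lra)).
  replace (gamma_factor A B c * (rpoch B k / rpoch (c - A) k)) with
    (scal (rpoch B k / rpoch c k) (Gamma (c + INR k) * Gamma (c + INR k - A - (B + INR k)) /
       (Gamma (c + INR k - A) * Gamma (c + INR k - (B + INR k))))).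
  - revert H. apply is_series_ext. intros j. unfold scal; simpl. unfold mult; simpl.
    unfold gauss_term, neg_binom. rewrite !rpoch_add.
    pose proof (rpoch_pos (c + INR k) j ltac:(lra)). pose proof (rpoch_pos 1 j Rlt_0_1).
    field. lra.
  - unfold scal; simpl. unfold mult; simpl. unfold gamma_factor.
    replace (c + INR k - A - (B + INR k)) with (c - A - B) by ring.
    replace (c + INR k - (B + INR k)) with (c - B) by ring.
    replace (c + INR k - A) with (c - A + INR k) by ring.
    rewrite !Gamma_add_nat by lra.
    pose proof (Gamma_pos (c - A) ltac:(lra)). pose proof (Gamma_pos (c - B) ltac:(lra)).
    field. lra.
Qed.

(* For [|x| < 1] the double series over [k] and [j] with [m = k + j] converges absolutely;
   summed by [j] first it is evaluated by Gauss's theorem. *)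
Lemma gauss_double_series (A B c x : R) :
  0 < A -> 0 < B -> A + B < c -> Rabs x < 1 ->
  ex_series (fun k => gauss_term A B (c - A) k * Rabs x ^ k) ->
  is_series (fun m => rpoch B m / rpoch c m * neg_binom2 A x m)
    (gamma_factor A B c * Series (fun k => gauss_term A B (c - A) k * x ^ k)).
Proof.
  intros HA HB Hc Hx Hex.
  set (w := fun m => rpoch B m / rpoch c m). set (al := neg_binom A).
  assert (Hw : forall m, 0 < w m) by (intros; apply Rdiv_lt_0_compat; apply rpoch_pos; lra).
  assert (Hal : forall m, 0 < al m) by (intros; now apply neg_binom_pos).
  set (g := fun k => gamma_factor A B c * (rpoch B k / rpoch (c - A) k)).
  assert (Hg : forall k, is_series (fun j => al j * w (k + j)%nat) (g k)).
  { intros k. now apply shifted_gauss_series. }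
  (* Row [k] of the triangle [k + j <= N], and 0 beyond it. The sum over [k] is the [N]-th partial
     sum in [m], while each row tends to its Gauss value and stays below it in absolute value up to
     [|x|^k] in place of [x^k]. *)
  set (u := fun N k => if (k <=? N)%nat then x ^ k * al k * sum_n (fun j => al j * w (k + j)%nat) (N - k) else 0).
  assert (Hlim : is_lim_seq (fun N => Series (u N)) (Series (fun k => x ^ k * al k * g k))).
  { apply tannery with (fun k => Rabs x ^ k * al k * g k).
    - intros N k. assert (H0 : 0 <= sum_n (fun j => al j * w (k + j)%nat) (N - k) <= g k).
      { split. rewrite sum_n_Reals. apply cond_pos_sum. intros j. apply Rmult_le_pos; left; auto.
        apply (is_lim_seq_incr_compare (sum_n (fun j => al j * w (k + j)%nat))).
        apply Hg. intros j. rewrite sum_Sn. unfold plus; simpl.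
        pose proof (Rmult_lt_0_compat _ _ (Hal (S j)) (Hw (k + S j)%nat)). lra. }
      pose proof (pow_le (Rabs x) k (Rabs_pos x)) as Hxk.
      assert (Hxa : 0 <= Rabs x ^ k * al k) by (apply Rmult_le_pos; auto; left; auto).
      unfold u. destruct (k <=? N)%nat.
      + rewrite !Rabs_mult, <- RPow_abs, (Rabs_pos_eq (al k)) by (left; auto).
        rewrite (Rabs_pos_eq (sum_n _ _)) by apply H0. apply Rmult_le_compat_l; [exact Hxa | apply H0].
      + rewrite Rabs_R0. apply Rmult_le_pos; lra.
    - apply ex_series_ext with (fun k => gamma_factor A B c * (gauss_term A B (c - A) k * Rabs x ^ k)).
      + intros k. unfold g, al, gauss_term, neg_binom.
        pose proof (rpoch_pos (c - A) k ltac:(lra)). pose proof (rpoch_pos 1 k Rlt_0_1).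
        match goal with |- @eq _ ?a ?b => change (@eq R a b) end. field. lra.
      + now apply (ex_series_scal_l (K := R_AbsRing) (V := R_NormedModule)).
    - intros k. unfold u.
      apply is_lim_seq_incr_n with k.
      apply is_lim_seq_ext with (fun N => x ^ k * al k * sum_n (fun j => al j * w (k + j)%nat) N).
      + intros N. rewrite (proj2 (Nat.leb_le k (N + k))) by lia. now rewrite Nat.add_sub.
      + apply (is_lim_seq_scal_l _ (x ^ k * al k) (g k)). apply Hg. }
  replace (gamma_factor A B c * Series (fun k => gauss_term A B (c - A) k * x ^ k))
    with (Series (fun k => x ^ k * al k * g k)).
  - revert Hlim. apply is_lim_seq_ext. intros N.
    unfold u. erewrite is_series_unique by apply is_series_truncate.
    transitivity (sum_n (fun k => sum_n (fun j => x ^ k * al k * (al j * w (k + j)%nat)) (N - k)) N).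
    + apply sum_n_R_ext. intros k _. now rewrite sum_n_Rmult_l.
    + rewrite <- (sum_n_triangle (fun k j => x ^ k * al k * (al j * w (k + j)%nat))).
      apply sum_n_R_ext. intros m _. unfold neg_binom2. rewrite <- sum_n_Rmult_l.
      apply sum_n_R_ext. intros k Hk. replace (k + (m - k))%nat with m by lia. fold al. unfold w. ring.
  - rewrite <- Series_scal_l. apply Series_ext. intros k. unfold g, al, gauss_term, neg_binom.
    pose proof (rpoch_pos (c - A) k ltac:(lra)). pose proof (rpoch_pos 1 k Rlt_0_1). field. lra.
Qed.

Definition clausen_term (A B c : R) (n : nat) : R :=
  rpoch A n * rpoch B (2 * n) / (rpoch c (2 * n) * rpoch 1 n).

Lemma clausen_term_pos (A B c : R) (n : nat) : 0 < A -> 0 < B -> 0 < c -> 0 < clausen_term A B c n.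
Proof.
  intros. unfold clausen_term. apply Rdiv_lt_0_compat; apply Rmult_lt_0_compat; apply rpoch_pos; lra.
Qed.

Lemma is_lim_seq_to_m1 : is_lim_seq (fun n => -1 + / (INR n + 1)) (-1).
Proof.
  replace (-1) with (-1 + 0) at 1 by ring.
  apply is_lim_seq_plus'; [apply is_lim_seq_const|].
  apply (is_lim_seq_ext (fun n => / INR (S n))). intros n. now rewrite S_INR.
  apply (is_lim_seq_incr_1 (fun n => / INR n)).
  apply (is_lim_seq_inv _ p_infty). apply is_lim_seq_INR. easy.
Qed.

(** [F] is a limit of values at points tending to -1, not the sum of the series at -1, since that
    series may diverge. *)
Theorem clausen_sum (A B c F : R) :
  0 < A -> 0 < B -> A + B < c -> B + 1 < c ->
  (forall r, 0 <= r < 1 -> ex_series (fun k => gauss_term A B (c - A) k * r ^ k)) ->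
  is_lim_seq (fun n => Series (fun k => gauss_term A B (c - A) k * (-1 + / (INR n + 1)) ^ k)) F ->
  is_series (clausen_term A B c) (gamma_factor A B c * F).
Proof.
  intros HA HB Hc Hc1 Hex HF.
  (* The bound on [neg_binom2] asks for [Q >= A] and [Q >= 1], and the majorant is summable when
     [Q + B < c]. For the maximum this amounts to the two hypotheses [A + B < c] and [B + 1 < c]. *)
  set (Q := Rmax A 1). assert (HQ : A <= Q /\ 1 <= Q) by (split; [apply Rmax_l | apply Rmax_r]).
  assert (HcQ : Q + B < c) by (unfold Q, Rmax; destruct Rle_dec; lra).
  set (M := gauss_term Q B c).
  set (w := fun m => rpoch B m / rpoch c m).
  assert (Hw : forall m, 0 < w m) by (intros; apply Rdiv_lt_0_compat; apply rpoch_pos; lra).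
  set (x := fun n => -1 + / (INR n + 1)).
  assert (Hx : forall n, -1 < x n <= 0).
  { intros n. unfold x. pose proof (pos_INR n).
    assert (0 < / (INR n + 1)) by (apply Rinv_0_lt_compat; lra).
    assert (/ (INR n + 1) <= / 1) by (apply Rinv_le_contravar; lra). lra. }
  assert (Hbound : forall y m, -1 <= y <= 0 -> Rabs (w m * neg_binom2 A y m) <= M m).
  { intros y m Hy. pose proof (neg_binom2_bound A Q y m ltac:(lra) ltac:(lra) Hy).
    specialize (Hw m).
    rewrite Rabs_pos_eq by (apply Rmult_le_pos; lra).
    apply Rle_trans with (w m * neg_binom Q m). apply Rmult_le_compat_l; lra.
    right. unfold M, w, gauss_term, neg_binom.
    pose proof (rpoch_pos c m ltac:(lra)). pose proof (rpoch_pos 1 m Rlt_0_1). field. lra. }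
  assert (HMex : ex_series M) by (apply gauss_term_ex_series; lra).
  assert (Hlim : is_lim_seq (fun n => Series (fun m => w m * neg_binom2 A (x n) m))
                  (Series (fun m => w m * neg_binom2 A (-1) m))).
  { apply tannery with M; auto.
    - intros n m. apply Hbound. specialize (Hx n). lra.
    - intros m. apply (is_lim_seq_scal_l _ (w m) (neg_binom2 A (-1) m)).
      unfold neg_binom2. apply (is_lim_seq_sum_n (fun n k => x n ^ k * neg_binom A k * neg_binom A (m - k))).
      intros k. apply (is_lim_seq_continuous (fun y => y ^ k * neg_binom A k * neg_binom A (m - k)) x (-1)).
      + apply derivable_continuous_pt. apply ex_derive_Reals_0. auto_derive; auto.
      + apply is_lim_seq_to_m1. }
  assert (HS : Series (fun m => w m * neg_binom2 A (-1) m) = gamma_factor A B c * F).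
  { apply is_lim_seq_scal_l with (a := gamma_factor A B c) in HF.
    apply is_lim_seq_ext with (v := fun n => Series (fun m => w m * neg_binom2 A (x n) m)) in HF.
    - apply is_lim_seq_unique in HF. apply is_lim_seq_unique in Hlim. rewrite Hlim in HF.
      now injection HF.
    - intros n. symmetry. apply is_series_unique. apply gauss_double_series; auto.
      + fold (x n). specialize (Hx n). rewrite Rabs_left1; lra.
      + fold (x n). apply Hex. specialize (Hx n). rewrite Rabs_left1; lra. }
  rewrite <- HS.
  assert (Hs : is_series (fun m => w m * neg_binom2 A (-1) m) (Series (fun m => w m * neg_binom2 A (-1) m))).
  { apply Series_correct. apply (ex_series_le (V := R_CompleteNormedModule) _ M); auto.
    intros m. apply Hbound. lra. }
  (* The terms of odd index vanish, so the partial sum up to [2 n] is the partial sum of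
     [clausen_term] up to [n]. *)
  assert (Hsub : is_lim_seq (fun n => sum_n (fun m => w m * neg_binom2 A (-1) m) (2 * n))
     (Series (fun m => w m * neg_binom2 A (-1) m))).
  { apply (is_lim_seq_subseq _ _ (fun n => (2 * n)%nat)); [|exact Hs].
    apply eventually_subseq. intros n. lia. }
  revert Hsub. apply is_lim_seq_ext. intros n.
  assert (Heven : forall n, w (2 * n)%nat * neg_binom2 A (-1) (2 * n) = clausen_term A B c n).
  { intros k. rewrite (proj1 (neg_binom2_m1 A k)). unfold w, neg_binom, clausen_term.
    pose proof (rpoch_pos c (2 * k) ltac:(lra)). pose proof (rpoch_pos 1 k Rlt_0_1). field. lra. }
  induction n as [|n IH].
  - rewrite !sum_O. exact (Heven 0%nat).
  - replace (2 * S n)%nat with (S (S (2 * n))) by lia. rewrite !sum_Sn, IH.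
    rewrite <- Heven. replace (2 * S n)%nat with (S (S (2 * n))) by lia.
    replace (neg_binom2 A (-1) (S (2 * n))) with 0.
    + unfold plus; simpl. ring.
    + symmetry. replace (S (2 * n)) with (2 * n + 1)%nat by lia. apply neg_binom2_m1.
Qed.

(** Raising [n] by one adds one factor to [(A)_n] and two to [(B)_(2n)] and [(c)_(2n)]. Split off at
    the front, they shift the parameters by 1, 2 and 2; the factor [n + 1] cancels against the
    factorial. *)
Lemma clausen_term_shift (A B c : R) (n : nat) : 0 < c ->
  INR (S n) * clausen_term A B c (S n)
  = A * (B * (B + 1)) / (c * (c + 1)) * clausen_term (A + 1) (B + 2) (c + 2) n.
Proof.
  intros Hc. unfold clausen_term.
  replace (2 * S n)%nat with (S (S (2 * n))) by lia.
  rewrite (rpoch_succ_l A), !(rpoch_succ_l B), !(rpoch_succ_l c), !(rpoch_succ_l (B + 1)), !(rpoch_succ_l (c + 1)).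
  cbn [rpoch]. replace (B + 1 + 1) with (B + 2) by ring. replace (c + 1 + 1) with (c + 2) by ring.
  pose proof (rpoch_pos (c + 2) (2 * n) ltac:(lra)). pose proof (rpoch_pos 1 n Rlt_0_1).
  pose proof (pos_INR n). rewrite S_INR. field. repeat split; lra.
Qed.

(** The shift keeps [c - B], raises [c - A] by one and lowers [c - A - B] by one, while
    [Gamma (c + 2)] absorbs [c (c + 1)]. This produces the denominators of the theorem. *)
Lemma gamma_factor_shift (A B c : R) : 0 < A -> 0 < B -> A + B + 1 < c ->
  A * (B * (B + 1)) / (c * (c + 1)) * gamma_factor (A + 1) (B + 2) (c + 2)
  = A * (B * (B + 1)) / ((c - A) * (c - A - B - 1)) * gamma_factor A B c.
Proof.
  intros HA HB Hc. unfold gamma_factor.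
  replace (c + 2 - (A + 1) - (B + 2)) with (c - A - B - 1) by ring.
  replace (c + 2 - (A + 1)) with (c - A + 1) by ring.
  replace (c + 2 - (B + 2)) with (c - B) by ring.
  replace (c + 2) with (c + 1 + 1) by ring.
  replace (Gamma (c - A - B)) with ((c - A - B - 1) * Gamma (c - A - B - 1)).
  2:{ rewrite <- Gamma_succ by lra. f_equal. ring. }
  rewrite !Gamma_succ by lra.
  pose proof (Gamma_pos (c - A) ltac:(lra)). pose proof (Gamma_pos (c - B) ltac:(lra)).
  field. repeat split; lra.
Qed.

Lemma clausen_index_sum (A B c s : R) : 0 < c ->
  is_series (clausen_term (A + 1) (B + 2) (c + 2)) s ->
  is_series (fun n => INR n * clausen_term A B c n) (A * (B * (B + 1)) / (c * (c + 1)) * s).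
Proof.
  intros Hc Hs. apply is_series_decr_1.
  replace (plus _ _) with (scal (A * (B * (B + 1)) / (c * (c + 1))) s).
  - apply (is_series_scal (K := R_AbsRing) (V := R_NormedModule) (A * (B * (B + 1)) / (c * (c + 1)))) in Hs.
    revert Hs. apply is_series_ext. intros n. symmetry. now apply clausen_term_shift.
  - unfold plus, opp, scal; simpl. unfold mult; simpl. ring.
Qed.

Lemma clausen_weighted_sum (A B c F0 F1 F2 : R) :
  0 < A -> 0 < B -> A + B + 2 < c ->
  is_series (clausen_term A B c) (gamma_factor A B c * F0) ->
  is_series (clausen_term (A + 1) (B + 2) (c + 2)) (gamma_factor (A + 1) (B + 2) (c + 2) * F1) ->
  is_series (clausen_term (A + 2) (B + 4) (c + 4)) (gamma_factor (A + 2) (B + 4) (c + 4) * F2) ->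
  is_series (fun n => (INR n + 1) * (2 * INR n + 1) * clausen_term A B c n)
    (gamma_factor A B c *
      (2 * rpoch A 2 * rpoch B 4 / (rpoch (c - A) 2 * rpoch (c - A - B - 2) 2) * F2
       + 5 * A * rpoch B 2 / ((c - A) * (c - A - B - 1)) * F1 + F0)).
Proof.
  intros HA HB Hc H0 H1 H2.
  assert (HI1 := clausen_index_sum A B c _ ltac:(lra) H1).
  replace (A + 2) with (A + 1 + 1) in H2 by ring. replace (B + 4) with (B + 2 + 2) in H2 by ring.
  replace (c + 4) with (c + 2 + 2) in H2 by ring.
  assert (HI2 := clausen_index_sum (A + 1) (B + 2) (c + 2) _ ltac:(lra) H2).
  set (k := A * (B * (B + 1)) / (c * (c + 1))) in *.
  set (k' := (A + 1) * ((B + 2) * (B + 2 + 1)) / ((c + 2) * (c + 2 + 1))) in *.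
  set (s2 := k * (k' * (gamma_factor (A + 1 + 1) (B + 2 + 2) (c + 2 + 2) * F2))).
  (* The term at 0 vanishes. At [n + 1] the summand is [n] times [(n + 1) T (n + 1)], that is [k]
     times the index-weighted term of the shifted parameters, which is shifted once more. *)
  assert (HI3 : is_series (fun n => INR n * (INR n - 1) * clausen_term A B c n) s2).
  { apply is_series_decr_1.
    replace (plus _ _) with (scal k (k' * (gamma_factor (A + 1 + 1) (B + 2 + 2) (c + 2 + 2) * F2))).
    - apply (is_series_scal (K := R_AbsRing) (V := R_NormedModule) k) in HI2. revert HI2.
      apply is_series_ext. intros n.
      transitivity (INR n * (INR (S n) * clausen_term A B c (S n))).
      + rewrite clausen_term_shift by lra. fold k. unfold scal; simpl. unfold mult; simpl. ring.
      + rewrite S_INR. match goal with |- @eq _ ?a ?b => change (@eq R a b) end. ring.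
    - unfold s2, plus, opp, scal; simpl. unfold mult; simpl. ring. }
  assert (HS : is_series (fun n => plus (plus (scal 2 (INR n * (INR n - 1) * clausen_term A B c n))
     (scal 5 (INR n * clausen_term A B c n))) (clausen_term A B c n))
     (plus (plus (scal 2 s2) (scal 5 (k * (gamma_factor (A + 1) (B + 2) (c + 2) * F1)))) (gamma_factor A B c * F0))).
  { apply (is_series_plus (K := R_AbsRing) (V := R_NormedModule)); [|exact H0].
    apply (is_series_plus (K := R_AbsRing) (V := R_NormedModule)); now apply (is_series_scal (K := R_AbsRing) (V := R_NormedModule)). }
  match type of HS with is_series _ ?l => replace (gamma_factor A B c *
      (2 * rpoch A 2 * rpoch B 4 / (rpoch (c - A) 2 * rpoch (c - A - B - 2) 2) * F2
       + 5 * A * rpoch B 2 / ((c - A) * (c - A - B - 1)) * F1 + F0)) with l end.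
  - revert HS. apply is_series_ext. intros n. unfold plus, scal; simpl. unfold mult; simpl. ring.
  - unfold plus, scal; simpl. unfold mult; simpl. unfold s2.
    pose proof (gamma_factor_shift A B c HA HB ltac:(lra)) as G1.
    pose proof (gamma_factor_shift (A + 1) (B + 2) (c + 2) ltac:(lra) ltac:(lra) ltac:(lra)) as G2.
    fold k in G1. fold k' in G2.
    replace (k * (k' * (gamma_factor (A + 1 + 1) (B + 2 + 2) (c + 2 + 2) * F2))) with
      (k * (k' * gamma_factor (A + 1 + 1) (B + 2 + 2) (c + 2 + 2)) * F2) by ring.
    rewrite G2.
    match goal with |- context [k * (?x * gamma_factor (A + 1) (B + 2) (c + 2))] =>
     replace (k * (x * gamma_factor (A + 1) (B + 2) (c + 2))) with (x * (k * gamma_factor (A + 1) (B + 2) (c + 2))) by ring end.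
    replace (k * (gamma_factor (A + 1) (B + 2) (c + 2) * F1)) with (k * gamma_factor (A + 1) (B + 2) (c + 2) * F1) by ring.
    rewrite G1. field. repeat split; lra.
Qed.

(** * Real parts of complex series, and the value of [2F1] at -1 *)

Lemma is_series_Re (u : nat -> C) (l : C) : is_series u l -> is_series (fun n => Re (u n)) (Re l).
Proof.
  intros H. unfold is_series in *.
  apply filterlim_ext with (fun n => Re (sum_n u n)).
  - intros n. induction n as [|n IH].
    + now rewrite !sum_O.
    + rewrite !sum_Sn. rewrite <- IH. reflexivity.
  - apply (filterlim_comp _ _ _ (sum_n u) Re _ (locally l)); [exact H|].
    intros P [eps HP]. exists eps. intros y Hy. apply HP. apply Hy.
Qed.

Lemma is_series_Im (u : nat -> C) (l : C) : is_series u l -> is_series (fun n => Im (u n)) (Im l).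
Proof.
  intros H. unfold is_series in *.
  apply filterlim_ext with (fun n => Im (sum_n u n)).
  - intros n. induction n as [|n IH].
    + now rewrite !sum_O.
    + rewrite !sum_Sn. rewrite <- IH. reflexivity.
  - apply (filterlim_comp _ _ _ (sum_n u) Im _ (locally l)); [exact H|].
    intros P [eps HP]. exists eps. intros y Hy. apply HP. apply Hy.
Qed.

Lemma pow_n_Cpow (z : C) (n : nat) : pow_n z n = Cpow z n.
Proof. induction n as [|n IH]; simpl; [reflexivity | now rewrite IH]. Qed.

Lemma RtoC_rpoch (x : R) (n : nat) : pochhammer (RtoC x) n = RtoC (rpoch x n).
Proof.
  induction n as [|n IH]; simpl; [reflexivity|]. now rewrite IH, RtoC_mult, RtoC_plus.
Qed.

Lemma is_pseries_real_Re (a : nat -> C) (x : R) (l : C) :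
  is_pseries a (RtoC x) l -> is_series (fun n => Re (a n) * x ^ n) (Re l).
Proof.
  intros H. apply is_series_Re in H. revert H. apply is_series_ext. intros n.
  rewrite pow_n_Cpow, <- RtoC_pow. destruct (a n) as [p q]. cbn. ring.
Qed.

(** On the real axis the real part of the local expansion is a real power series, continuous inside
    its interval of convergence. This reaches boundary points of the disc that lie in [U]. *)
Lemma analytic_real_cont (U : C -> Prop) (F : C -> C) (x0 : R) (h : nat -> R) :
  analytic_on U F -> U (RtoC x0) -> is_lim_seq h 0 ->
  is_lim_seq (fun n => Re (F (RtoC (x0 + h n)))) (Re (F (RtoC x0))).
Proof.
  intros HF HU Hh. destruct (HF _ HU) as (a & r & Hr & Ha).
  assert (Hre : forall t, Rabs t < r -> is_series (fun n => Re (a n) * t ^ n) (Re (F (RtoC (x0 + t))))).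
  { intros t Ht. apply is_pseries_real_Re.
    replace (RtoC t) with (RtoC (x0 + t) - RtoC x0)%C by (rewrite RtoC_plus; ring).
    apply Ha. rewrite <- RtoC_minus, Cmod_R. now replace (x0 + t - x0) with t by ring. }
  assert (HP : forall t, Rabs t < r -> PSeries (fun n => Re (a n)) t = Re (F (RtoC (x0 + t)))).
  { intros t Ht. apply is_series_unique. now apply Hre. }
  assert (Hcv : Rbar_lt (Rabs 0) (CV_radius (fun n => Re (a n)))).
  { rewrite Rabs_R0. apply Rbar_lt_le_trans with (r / 2); [simpl; lra|].
    apply Rbar_not_lt_le. intros Hlt.
    assert (Hr2 : Rabs (r / 2) = r / 2) by (apply Rabs_pos_eq; lra).
    rewrite <- Hr2 in Hlt. apply CV_disk_outside in Hlt. apply Hlt.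
    apply ex_series_lim_0. eexists. apply Hre. lra. }
  apply PSeries_continuity in Hcv.
  pose proof (is_lim_seq_continuous _ h 0 Hcv Hh) as Hlim.
  rewrite HP in Hlim by (rewrite Rabs_R0; lra). rewrite Rplus_0_r in Hlim.
  revert Hlim. apply is_lim_seq_ext_loc.
  apply is_lim_seq_spec in Hh. destruct (Hh (mkposreal r Hr)) as [N HN].
  exists N. intros n Hn. apply HP. specialize (HN n Hn). simpl in HN. now rewrite Rminus_0_r in HN.
Qed.

Lemma slit_plane_m1 : slit_plane (RtoC (-1)).
Proof. intros [_ H]. simpl in H. lra. Qed.

Lemma hyp2F1_real_series (A B D : R) (F : C -> C) (x : R) :
  0 < D -> is_hyp2F1 (RtoC A) (RtoC B) (RtoC D) F -> Rabs x < 1 ->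
  is_series (fun k => gauss_term A B D k * x ^ k) (Re (F (RtoC x))).
Proof.
  intros HD [_ HF] Hx.
  assert (Hu : unit_disc (RtoC x)) by (unfold unit_disc; now rewrite Cmod_R).
  specialize (HF _ Hu). apply is_pseries_real_Re in HF. revert HF. apply is_series_ext.
  intros n. f_equal. rewrite !RtoC_rpoch, <- !RtoC_mult, <- RtoC_div.
  reflexivity.
  pose proof (rpoch_pos D n HD). pose proof (rpoch_pos 1 n Rlt_0_1). nra.
Qed.

(** The point -1 is on the boundary of the disc but inside the slit plane; continuity there
    identifies the limit required by [clausen_sum] with the value of the continuation. *)
Lemma clausen_sum_hyp2F1 (A B c : R) (F : C -> C) :
  0 < A -> 0 < B -> A + B < c -> B + 1 < c ->
  is_hyp2F1 (RtoC A) (RtoC B) (RtoC (c - A)) F ->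
  is_series (clausen_term A B c) (gamma_factor A B c * Re (F (RtoC (-1)))).
Proof.
  intros HA HB Hc Hc1 HF.
  assert (HS : forall x, Rabs x < 1 -> is_series (fun k => gauss_term A B (c - A) k * x ^ k) (Re (F (RtoC x)))).
  { intros x Hx. apply hyp2F1_real_series; auto. lra. }
  apply clausen_sum; auto.
  - intros r Hr. eexists. apply HS. rewrite Rabs_pos_eq; lra.
  - assert (Hlim : is_lim_seq (fun n => / (INR n + 1)) 0).
    { apply (is_lim_seq_ext (fun n => (-1 + / (INR n + 1)) - (-1))). intros; ring.
      replace 0 with (-1 - -1) by ring. apply is_lim_seq_minus'. apply is_lim_seq_to_m1. apply is_lim_seq_const. }
    pose proof (analytic_real_cont _ F (-1) _ (proj1 HF) slit_plane_m1 Hlim) as H.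
    apply is_lim_seq_incr_1. apply is_lim_seq_incr_1 in H. revert H. apply is_lim_seq_ext.
    intros n. symmetry. apply is_series_unique. apply HS.
    rewrite S_INR. pose proof (pos_INR n).
    assert (0 < / (INR n + 1 + 1)) by (apply Rinv_0_lt_compat; lra).
    assert (/ (INR n + 1 + 1) <= / 1) by (apply Rinv_le_contravar; lra).
    apply Rabs_def1; lra.
Qed.

(** * Complex power series *)

Open Scope C_scope.

Local Ltac as_C := match goal with |- @eq _ ?x ?y => change (@eq C x y) end.

Lemma is_pseries_C (a : nat -> C) (z l : C) :
  is_pseries a z l <-> is_series (fun n => a n * z ^ n) l.
Proof.
  assert (He : forall n, scal (pow_n (K := C_Ring) z n) (a n) = a n * z ^ n).
  { intros n. rewrite pow_n_Cpow. apply Cmult_comm. }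
  split; apply is_series_ext; intros n; [apply He | symmetry; apply He].
Qed.

Lemma CSeries_unique (u : nat -> C) (l : C) : is_series u l -> CSeries u = l.
Proof.
  intros H. unfold CSeries.
  rewrite (is_series_unique _ _ (is_series_Re _ _ H)), (is_series_unique _ _ (is_series_Im _ _ H)).
  now destruct l.
Qed.

Lemma CSeries_correct (u : nat -> C) : ex_series u -> is_series u (CSeries u).
Proof. intros [l H]. now rewrite (CSeries_unique u l H). Qed.

Lemma ex_CSeries_le (u : nat -> C) (M : nat -> R) :
  (forall n, (Cmod (u n) <= M n)%R) -> ex_series M -> ex_series u.
Proof. apply (ex_series_le (V := C_CompleteNormedModule)). Qed.

(** Radius of convergence at least 1, phrased with moduli so that real majorants apply directly. *)
Definition abs_conv (a : nat -> C) : Prop :=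
  forall r : R, (0 <= r < 1)%R -> ex_series (fun n => Cmod (a n) * r ^ n)%R.

Definition cps (a : nat -> C) (z : C) : C := CSeries (fun n => a n * z ^ n).

Lemma cps_spec (a : nat -> C) (z : C) :
  abs_conv a -> unit_disc z -> is_series (fun n => a n * z ^ n) (cps a z).
Proof.
  intros Ha Hz. apply CSeries_correct.
  apply ex_CSeries_le with (fun n => Cmod (a n) * Cmod z ^ n)%R.
  - intros n. rewrite Cmod_mult, Cmod_pow. lra.
  - apply Ha. split; [apply Cmod_ge_0 | exact Hz].
Qed.

Definition cder (a : nat -> C) (n : nat) : C := RtoC (INR (S n)) * a (S n).

Lemma Cmod_cder (a : nat -> C) (n : nat) : Cmod (cder a n) = (INR (S n) * Cmod (a (S n)))%R.
Proof. unfold cder. rewrite Cmod_mult, Cmod_R, Rabs_pos_eq; auto using pos_INR. Qed.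

(** The moduli form a real power series, and termwise differentiation preserves its radius;
    convergence at [(1 + r) / 2] puts [r] strictly inside. *)
Lemma abs_conv_cder (a : nat -> C) : abs_conv a -> abs_conv (cder a).
Proof.
  intros Ha r Hr. set (b := fun n => Cmod (a n)).
  assert (Hcv : Rbar_lt (Rabs r) (CV_radius b)).
  { rewrite Rabs_pos_eq by lra. apply Rbar_lt_le_trans with ((1 + r) / 2)%R; [simpl; lra|].
    apply Rbar_not_lt_le. intros Hlt.
    assert (Hr2 : Rabs ((1 + r) / 2) = ((1 + r) / 2)%R) by (apply Rabs_pos_eq; lra).
    rewrite <- Hr2 in Hlt. apply CV_disk_outside in Hlt. apply Hlt.
    apply ex_series_lim_0. apply (Ha ((1 + r) / 2)%R). lra. }
  apply ex_pseries_derive in Hcv. apply ex_pseries_R in Hcv.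
  revert Hcv. apply ex_series_ext. intros n. rewrite Cmod_cder. reflexivity.
Qed.

(** The mean-value bound [n r^(n-1) |y - z|], multiplied by [r] so that no exponent [n - 1] has to
    be read at [n = 0]. *)
Lemma Cpow_diff_bound (y z : C) (r : R) (n : nat) :
  (Cmod y <= r)%R -> (Cmod z <= r)%R ->
  (Cmod (y ^ n - z ^ n) * r <= INR n * r ^ n * Cmod (y - z))%R.
Proof.
  intros Hy Hz. pose proof (Cmod_ge_0 z) as H0. pose proof (Cmod_ge_0 y) as H0'.
  induction n as [|n IH].
  - simpl. replace (1 - 1) with (RtoC 0) by ring. rewrite Cmod_0. lra.
  - replace (y ^ S n - z ^ S n) with (z * (y ^ n - z ^ n) + (y - z) * y ^ n) by (simpl; ring).
    assert (H1 : (Cmod (z * (y ^ n - z ^ n) + (y - z) * y ^ n)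
                   <= Cmod z * Cmod (y ^ n - z ^ n) + Cmod (y - z) * Cmod y ^ n)%R).
    { eapply Rle_trans; [apply Cmod_triangle|]. rewrite !Cmod_mult, Cmod_pow. lra. }
    pose proof (Cmod_ge_0 (y ^ n - z ^ n)) as H2. pose proof (Cmod_ge_0 (y - z)) as H3.
    pose proof (pow_incr (Cmod y) r n (conj H0' Hy)) as H4.
    rewrite S_INR. simpl (r ^ S n)%R.
    apply Rle_trans with ((r * Cmod (y ^ n - z ^ n) + Cmod (y - z) * r ^ n) * r)%R.
    + apply Rmult_le_compat_r; [lra|]. eapply Rle_trans; [exact H1|].
      apply Rplus_le_compat; [apply Rmult_le_compat_r | apply Rmult_le_compat_l]; lra.
    + assert (r * (Cmod (y ^ n - z ^ n) * r) <= r * (INR n * r ^ n * Cmod (y - z)))%R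
        by (apply Rmult_le_compat_l; lra). lra.
Qed.

(** The remainder bound [n (n-1) r^(n-2) |y - z|^2], likewise multiplied by [r^2]. Each step
    multiplies the old remainder by [z] and adds [(y - z) (y^n - z^n)]. *)
Lemma Cpow_taylor_bound (y z : C) (r : R) (n : nat) :
  (Cmod y <= r)%R -> (Cmod z <= r)%R ->
  (Cmod (y ^ n - z ^ n - RtoC (INR n) * z ^ pred n * (y - z)) * r ^ 2
    <= INR n * (INR n - 1) * r ^ n * Cmod (y - z) ^ 2)%R.
Proof.
  intros Hy Hz. pose proof (Cmod_ge_0 z) as H0.
  induction n as [|n IH].
  - simpl. replace (1 - 1 - 0 * 1 * (y - z)) with (RtoC 0) by ring. rewrite Cmod_0. lra.
  - set (e := y ^ n - z ^ n - RtoC (INR n) * z ^ pred n * (y - z)) in *.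
    replace (y ^ S n - z ^ S n - RtoC (INR (S n)) * z ^ pred (S n) * (y - z))
      with (z * e + (y - z) * (y ^ n - z ^ n)).
    2:{ unfold e. rewrite S_INR, RtoC_plus. destruct n as [|n]; simpl; ring. }
    assert (H1 : (Cmod (z * e + (y - z) * (y ^ n - z ^ n))
                   <= Cmod z * Cmod e + Cmod (y - z) * Cmod (y ^ n - z ^ n))%R).
    { eapply Rle_trans; [apply Cmod_triangle|]. rewrite !Cmod_mult. lra. }
    pose proof (Cpow_diff_bound y z r n Hy Hz) as H2.
    pose proof (Cmod_ge_0 e) as H3. pose proof (Cmod_ge_0 (y - z)) as H4.
    assert (H5 : (Cmod z * Cmod e <= r * Cmod e)%R) by (apply Rmult_le_compat_r; lra).
    rewrite S_INR. simpl (r ^ S n)%R.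
    apply Rle_trans with ((r * Cmod e + Cmod (y - z) * Cmod (y ^ n - z ^ n)) * r ^ 2)%R.
    + apply Rmult_le_compat_r; [apply pow2_ge_0|]. lra.
    + assert (r * (Cmod e * r ^ 2) <= r * (INR n * (INR n - 1) * r ^ n * Cmod (y - z) ^ 2))%R
        by (apply Rmult_le_compat_l; lra).
      assert (Cmod (y - z) * r * (Cmod (y ^ n - z ^ n) * r) <= Cmod (y - z) * r * (INR n * r ^ n * Cmod (y - z)))%R
        by (apply Rmult_le_compat_l; [apply Rmult_le_pos; lra | lra]).
      assert (0 <= INR n * r ^ n * r * Cmod (y - z) ^ 2)%R.
      { pose proof (pos_INR n). pose proof (pow_le r n ltac:(lra)).
        apply Rmult_le_pos; [|apply pow2_ge_0]. apply Rmult_le_pos; [|lra]. apply Rmult_le_pos; lra. }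
      lra.
Qed.

(** Aligns the derivative with [a n * z ^ n] index by index, so that the Taylor remainder can be
    taken termwise; at [n = 0] the factor [INR 0] removes the term. *)
Lemma cder_series (a : nat -> C) (z : C) : abs_conv a -> unit_disc z ->
  is_series (fun n => a n * (RtoC (INR n) * z ^ pred n)) (cps (cder a) z).
Proof.
  intros Ha Hz. apply is_series_decr_1.
  replace (plus _ _) with (cps (cder a) z).
  - generalize (cps_spec _ _ (abs_conv_cder a Ha) Hz). apply is_series_ext. intros n.
    unfold cder. simpl pred. as_C. ring.
  - unfold plus, opp; cbn. as_C. ring.
Qed.

Lemma cps_taylor1 (a : nat -> C) (z : C) : abs_conv a -> unit_disc z ->
  exists K d : R, (0 < d)%R /\ (0 <= K)%R /\ forall y : C, (Cmod (y - z) < d)%R ->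
    (Cmod (cps a y - cps a z - (y - z) * cps (cder a) z) <= K * Cmod (y - z) ^ 2)%R.
Proof.
  intros Ha Hz. unfold unit_disc in Hz. pose proof (Cmod_ge_0 z) as Hz0.
  set (r := ((1 + Cmod z) / 2)%R). assert (Hr : (0 < r < 1)%R) by (unfold r; lra).
  (* [N n] is [n (n-1) |a n| r^(n-2)], summable through the second derivative. The midpoint [r]
     leaves room for all [y] within [(1 - |z|) / 2] of [z]. *)
  set (N := fun n => match n with S (S k) => (Cmod (cder (cder a) k) * r ^ k)%R | _ => 0%R end).
  assert (HN0 : forall n, (0 <= N n)%R).
  { intros [|[|n]]; simpl; try lra. apply Rmult_le_pos. apply Cmod_ge_0. apply pow_le; lra. }
  assert (HN : ex_series N).
  { apply ex_series_incr_1, ex_series_incr_1. simpl.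
    apply (abs_conv_cder _ (abs_conv_cder _ Ha)). lra. }
  exists (Series N), ((1 - Cmod z) / 2)%R. split; [lra|]. split.
  { rewrite <- (Rmult_0_l (Series N)), <- Series_scal_l. apply Series_le; auto.
    intros n. specialize (HN0 n). lra. }
  intros y Hy.
  assert (Hyr : (Cmod y <= r)%R).
  { replace y with (z + (y - z)) by ring. eapply Rle_trans; [apply Cmod_triangle|]. unfold r. lra. }
  assert (Hzr : (Cmod z <= r)%R) by (unfold r; lra).
  pose proof (cps_spec a y Ha ltac:(unfold unit_disc; lra)) as S1.
  pose proof (cps_spec a z Ha Hz) as S2. pose proof (cder_series a z Ha Hz) as S3.
  apply (is_series_scal (V := C_NormedModule) (y - z)) in S3.
  pose proof (is_series_minus _ _ _ _ (is_series_minus _ _ _ _ S1 S2) S3) as S4.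
  rewrite Rmult_comm.
  apply (is_series_norm_le (V := C_NormedModule) _ _ (fun n => Cmod (y - z) ^ 2 * N n)%R _ S4).
  - intros n. match goal with |- (norm ?X <= ?B)%R => change (Cmod X <= B)%R end.
    match goal with |- (Cmod ?X <= _)%R =>
      replace X with (a n * (y ^ n - z ^ n - RtoC (INR n) * z ^ pred n * (y - z))) end.
    2:{ unfold plus, opp, scal; cbn -[Cpow INR pred]. as_C. ring. }
    rewrite Cmod_mult. pose proof (Cpow_taylor_bound y z r n Hyr Hzr) as Hb.
    set (E := Cmod (y ^ n - z ^ n - RtoC (INR n) * z ^ pred n * (y - z))) in *.
    assert (Hr2 : (0 < r ^ 2)%R) by (apply pow_lt; lra).
    apply Rmult_le_reg_r with (r ^ 2)%R; [easy|].
    apply Rle_trans with (Cmod (a n) * (INR n * (INR n - 1) * r ^ n * Cmod (y - z) ^ 2))%R.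
    + rewrite Rmult_assoc. apply Rmult_le_compat_l; [apply Cmod_ge_0 | exact Hb].
    + right. destruct n as [|[|n]]; unfold N.
      * simpl (INR 0). ring.
      * simpl (INR 1). ring.
      * rewrite !Cmod_cder. rewrite !(S_INR (S n)), S_INR. simpl (r ^ S (S n))%R. ring.
  - apply (is_series_scal (K := R_AbsRing) (V := R_NormedModule)). now apply Series_correct.
Qed.

Lemma is_derive_cps (a : nat -> C) (z : C) : abs_conv a -> unit_disc z ->
  is_derive (V := C_NormedModule) (cps a) z (cps (cder a) z).
Proof.
  intros Ha Hz. split; [apply is_linear_scal_l|].
  intros x Hx. apply (is_filter_lim_locally_unique (V := AbsRing_NormedModule C_AbsRing)) in Hx. subst x.
  intros eps. destruct (cps_taylor1 a z Ha Hz) as (K & d & Hd & HK & Hb).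
  assert (Hd' : (0 < Rmin d (eps / (K + 1)))%R).
  { apply Rmin_pos; [easy|]. apply Rdiv_lt_0_compat; [apply cond_pos | lra]. }
  exists (mkposreal _ Hd'). intros y Hy.
  assert (Hy' : (Cmod (y - z) < Rmin d (eps / (K + 1)))%R) by exact Hy.
  assert (Hy1 : (Cmod (y - z) < d)%R) by (eapply Rlt_le_trans; [exact Hy' | apply Rmin_l]).
  assert (Hy2 : (Cmod (y - z) <= eps / (K + 1))%R) by (left; eapply Rlt_le_trans; [exact Hy' | apply Rmin_r]).
  change (norm (minus y z)) with (Cmod (y - z)).
  match goal with |- (norm ?X <= ?B)%R => change (Cmod X <= B)%R end.
  eapply Rle_trans; [exact (Hb y Hy1)|].
  pose proof (Cmod_ge_0 (y - z)) as H0.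
  simpl (_ ^ 2)%R. rewrite Rmult_1_r, <- Rmult_assoc. apply Rmult_le_compat_r; [easy|].
  apply Rle_trans with ((K + 1) * (eps / (K + 1)))%R.
  - apply Rmult_le_compat; lra.
  - right. field. lra.
Qed.

(* The coefficient of [h ^ k] in [(z + h) ^ n]. *)
Fixpoint shift_coef (z : C) (n k : nat) : C :=
  match n, k with
  | O, O => 1
  | O, S _ => 0
  | S m, O => z * shift_coef z m 0
  | S m, S j => z * shift_coef z m (S j) + shift_coef z m j
  end.

Definition shift_poly (z h : C) (n K : nat) : C := sum_n (fun k => shift_coef z n k * h ^ k) K.

Lemma shift_poly_0_l (z h : C) (K : nat) : shift_poly z h 0 K = 1.
Proof.
  unfold shift_poly. induction K as [|K IH].
  - rewrite sum_O. simpl. ring.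
  - rewrite sum_Sn, IH. unfold plus; simpl. ring.
Qed.

Lemma shift_poly_succ_0 (z h : C) (n : nat) : shift_poly z h (S n) 0 = z * shift_poly z h n 0.
Proof. unfold shift_poly. rewrite !sum_O. simpl. ring. Qed.

Lemma shift_poly_succ_r (z h : C) (n K : nat) :
  shift_poly z h n (S K) = shift_poly z h n K + shift_coef z n (S K) * h ^ S K.
Proof. unfold shift_poly. now rewrite sum_Sn. Qed.

Lemma shift_poly_succ_succ (z h : C) (n K : nat) :
  shift_poly z h (S n) (S K) = z * shift_poly z h n (S K) + h * shift_poly z h n K.
Proof.
  induction K as [|K IH].
  - rewrite !shift_poly_succ_r. unfold shift_poly. rewrite !sum_O. simpl. ring.
  - rewrite shift_poly_succ_r, IH, (shift_poly_succ_r z h n (S K)), (shift_poly_succ_r z h n K).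
    simpl. ring.
Qed.

Lemma shift_poly_full (z h : C) (n K : nat) : (n <= K)%nat -> shift_poly z h n K = (z + h) ^ n.
Proof.
  revert K. induction n as [|n IH]; intros K HK.
  - apply shift_poly_0_l.
  - destruct K as [|K]; [lia|]. rewrite shift_poly_succ_succ, !IH by lia. simpl. ring.
Qed.

(** Every truncation obeys the bound of the full power, with no factor for the number of terms,
    because the Pascal recursion expresses it by truncations of the previous power. *)
Lemma shift_poly_bound (z h : C) (n K : nat) :
  (Cmod (shift_poly z h n K) <= (Cmod z + Cmod h) ^ n)%R.
Proof.
  pose proof (Cmod_ge_0 z). pose proof (Cmod_ge_0 h).
  revert K. induction n as [|n IH]; intros K.
  - rewrite shift_poly_0_l, Cmod_1. simpl. lra.
  - assert (H1 : (0 <= (Cmod z + Cmod h) ^ n)%R) by (apply pow_le; lra).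
    destruct K as [|K].
    + rewrite shift_poly_succ_0, Cmod_mult. simpl.
      specialize (IH 0%nat).
      apply Rmult_le_compat; auto using Cmod_ge_0; lra.
    + rewrite shift_poly_succ_succ. eapply Rle_trans; [apply Cmod_triangle|].
      rewrite !Cmod_mult. simpl. rewrite Rmult_plus_distr_r.
      apply Rplus_le_compat; apply Rmult_le_compat_l; auto.
Qed.

(** A Cauchy estimate: for [k > 0] the [k]-th term at [h = s] is the difference of two consecutive
    truncations, each at most [(|z| + s)^n]; hence the factor 2. *)
Lemma shift_coef_bound (z : C) (s : R) (n k : nat) : (0 < s)%R ->
  (Cmod (shift_coef z n k) <= 2 * (Cmod z + s) ^ n / s ^ k)%R.
Proof.
  intros Hs. assert (Hsk : (0 < s ^ k)%R) by now apply pow_lt.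
  assert (Hcs : Cmod (RtoC s) = s) by (rewrite Cmod_R; apply Rabs_pos_eq; lra).
  apply Rmult_le_reg_r with (s ^ k)%R; [easy|].
  replace (2 * (Cmod z + s) ^ n / s ^ k * s ^ k)%R with (2 * (Cmod z + s) ^ n)%R by (field; lra).
  replace (Cmod (shift_coef z n k) * s ^ k)%R with (Cmod (shift_coef z n k * RtoC s ^ k))
    by (now rewrite Cmod_mult, Cmod_pow, Hcs).
  pose proof (fun K => shift_poly_bound z (RtoC s) n K) as Hb. rewrite Hcs in Hb.
  destruct k as [|k].
  - specialize (Hb 0%nat). unfold shift_poly in Hb. rewrite sum_O in Hb.
    pose proof (Cmod_ge_0 z). pose proof (pow_le (Cmod z + s) n ltac:(lra)). lra.
  - replace (shift_coef z n (S k) * RtoC s ^ S k) with (shift_poly z s n (S k) + - shift_poly z s n k).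
    2:{ rewrite shift_poly_succ_r. ring. }
    eapply Rle_trans; [apply Cmod_triangle|]. rewrite Cmod_opp.
    pose proof (Hb k). pose proof (Hb (S k)). lra.
Qed.

(* The Taylor polynomial of order [K] at [z] replaces each [(z + h) ^ n] by its truncation,
   which is exact for [n <= K]; the error is thus a tail of the absolutely convergent series. *)
Lemma cps_reexpand (a : nat -> C) (z : C) : abs_conv a -> unit_disc z ->
  exists b : nat -> C, forall h : C, (Cmod h < 1 - Cmod z)%R -> is_pseries b h (cps a (z + h)).
Proof.
  intros Ha Hz. unfold unit_disc in Hz. pose proof (Cmod_ge_0 z) as Hz0.
  set (b := fun k => CSeries (fun n => a n * shift_coef z n k)).
  assert (Hb : forall k, is_series (fun n => a n * shift_coef z n k) (b k)).
  { intros k. apply CSeries_correct. set (s := ((1 - Cmod z) / 2)%R).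
    apply ex_CSeries_le with (fun n => 2 / s ^ k * (Cmod (a n) * (Cmod z + s) ^ n))%R.
    - intros n. rewrite Cmod_mult.
      assert (Hs : (0 < s)%R) by (unfold s; lra).
      assert (Hsk : (0 < s ^ k)%R) by now apply pow_lt.
      replace (2 / s ^ k * (Cmod (a n) * (Cmod z + s) ^ n))%R
        with (Cmod (a n) * (2 * (Cmod z + s) ^ n / s ^ k))%R by (field; lra).
      apply Rmult_le_compat_l; [apply Cmod_ge_0 | now apply shift_coef_bound].
    - apply (ex_series_scal_l (K := R_AbsRing) (V := R_NormedModule)). apply Ha. unfold s; lra. }
  exists b. intros h Hh. pose proof (Cmod_ge_0 h) as Hh0.
  set (r := (Cmod z + Cmod h)%R). assert (Hr : (0 <= r < 1)%R) by (unfold r; lra).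
  assert (Hzh : (Cmod (z + h) <= r)%R) by apply Cmod_triangle.
  (* The factor 2 accounts for the power and its truncation, each bounded by [r^n]. *)
  set (M := fun n => (2 * (Cmod (a n) * r ^ n))%R).
  assert (HM : is_series M (Series M)).
  { apply Series_correct. apply (ex_series_scal_l (K := R_AbsRing) (V := R_NormedModule)). now apply Ha. }
  assert (HP : forall K, is_series (fun n => a n * shift_poly z h n K)
                 (sum_n (fun k => scal (pow_n (K := C_Ring) h k) (b k)) K)).
  { induction K as [|K IH].
    - rewrite sum_O. generalize (is_series_scal (V := C_NormedModule) (pow_n (K := C_Ring) h 0) _ _ (Hb 0%nat)).
      apply is_series_ext. intros n. unfold shift_poly. rewrite sum_O, pow_n_Cpow. unfold scal; cbn. as_C. ring.
    - rewrite sum_Sn.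
      generalize (is_series_plus _ _ _ _ IH (is_series_scal (V := C_NormedModule) (pow_n (K := C_Ring) h (S K)) _ _ (Hb (S K)))).
      apply is_series_ext. intros n. rewrite shift_poly_succ_r, pow_n_Cpow.
      unfold plus, scal; cbn -[shift_coef Cpow]. as_C. ring. }
  assert (Herr : forall K, (Cmod (cps a (z + h) - sum_n (fun k => scal (pow_n (K := C_Ring) h k) (b k)) K)
                   <= Series M - sum_n M K)%R).
  { intros K.
    pose proof (is_series_minus _ _ _ _ (cps_spec a (z + h) Ha ltac:(unfold unit_disc; lra)) (HP K)) as HD.
    set (D := fun n => plus (a n * (z + h) ^ n) (opp (a n * shift_poly z h n K))) in HD.
    assert (HDn : forall n, D n = a n * ((z + h) ^ n - shift_poly z h n K)).
    { intros n. unfold D, plus, opp; cbn -[Cpow]. as_C. ring. }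
    assert (H0 : forall m, (m <= K)%nat -> sum_n D m = RtoC 0).
    { induction m as [|m IHm]; intros Hm.
      - rewrite sum_O, HDn, shift_poly_full by easy. as_C. ring.
      - rewrite sum_Sn, IHm, HDn, shift_poly_full by lia. unfold plus; cbn -[Cpow]. as_C. ring. }
    assert (HMn : forall n, (Cmod (D n) <= M n)%R).
    { intros n. rewrite HDn, Cmod_mult. unfold M.
      replace (2 * (Cmod (a n) * r ^ n))%R with (Cmod (a n) * (r ^ n + r ^ n))%R by ring.
      apply Rmult_le_compat_l; [apply Cmod_ge_0|].
      eapply Rle_trans; [apply Cmod_triangle|]. rewrite Cmod_opp, Cmod_pow.
      apply Rplus_le_compat; [apply pow_incr; split; [apply Cmod_ge_0 | easy] | apply shift_poly_bound]. }
    pose proof (is_series_tail_norm (V := C_NormedModule) D _ M _ K HD HMn HM) as Ht.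
    rewrite H0 in Ht by easy.
    match goal with |- (Cmod ?X <= _)%R =>
      match type of Ht with (norm ?Y <= _)%R => replace X with Y; [exact Ht|] end end.
    unfold minus, plus, opp; cbn -[sum_n]. as_C. ring. }
  intros P [eps HPe].
  pose proof (proj2 (is_lim_seq_spec (sum_n M) (Series M)) HM eps) as [N HN].
  exists N. intros n Hn. apply HPe. apply C_NormedModule_mixin_compat1.
  specialize (HN n Hn). apply Rabs_def2 in HN. specialize (Herr n).
  match type of Herr with (Cmod ?X <= _)%R =>
    match goal with |- (Cmod ?Y < _)%R => replace Y with (- X) end end.
  - rewrite Cmod_opp. lra.
  - match goal with |- - (?f - ?S) = _ => change (@eq C (- (f - S)) (S + - f)) end. ring.
Qed.

(** * Uniform convexity *)

Lemma analytic_on_cps (f : C -> C) (a : nat -> C) : abs_conv a ->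
  (forall z, unit_disc z -> f z = cps a z) -> analytic_on unit_disc f.
Proof.
  intros Ha Hf z Hz. destruct (cps_reexpand a z Ha Hz) as [b Hb].
  exists b, (1 - Cmod z)%R. unfold unit_disc in Hz. split; [lra|].
  intros y Hy. rewrite Hf.
  - replace y with (z + (y - z)) at 2 by ring. now apply Hb.
  - unfold unit_disc. replace y with (z + (y - z)) by ring.
    eapply Rle_lt_trans; [apply Cmod_triangle|]. lra.
Qed.

(** Agreement with the power series is asked for on the disc only, so that the lemma applies again
    to [C_derive f], which is known only there. *)
Lemma C_derive_cps (f : C -> C) (a : nat -> C) (z : C) : abs_conv a ->
  (forall y, unit_disc y -> f y = cps a y) -> unit_disc z -> C_derive f z = cps (cder a) z.
Proof.
  intros Ha Hf Hz. apply is_C_derive_unique.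
  apply (is_derive_ext_loc (cps a)); [|now apply is_derive_cps].
  unfold unit_disc in Hz. assert (Hd : (0 < 1 - Cmod z)%R) by lra.
  exists (mkposreal _ Hd). intros y Hy. symmetry. apply Hf.
  assert (Hy' : (Cmod (y - z) < 1 - Cmod z)%R) by exact Hy.
  unfold unit_disc. replace y with (z + (y - z)) by ring.
  eapply Rle_lt_trans; [apply Cmod_triangle|]. lra.
Qed.

Lemma Re_1_plus_pos (w : C) : (Cmod w < 1)%R -> (0 < Re (1 + w))%R.
Proof.
  intros Hw. pose proof (re_le_Cmod w) as H. apply Rabs_le_between in H.
  unfold Re in *. simpl. lra.
Qed.

(* [1 - |f' - 1|] bounds [|f'|] from below, and [|(z - zeta) f''| < 2 |f''|] on the disc. *)
Lemma UCV_of_coefficients (f : C -> C) (a : nat -> C) (T : nat -> R) (s : R) :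
  a 0%nat = 0 -> a 1%nat = 1 ->
  (forall n, (0 < T n)%R) -> T 0%nat = 1%R -> (forall n, (Cmod (a (S n)) <= T n)%R) ->
  is_series (fun n => (INR n + 1) * (2 * INR n + 1) * T n)%R s -> (s <= 2)%R ->
  (forall z, unit_disc z -> is_pseries a z (f z)) -> UCV f.
Proof.
  intros Ha0 Ha1 HT HT0 HaT Hs Hs2 Hf.
  assert (Hex : forall M : nat -> R,
     (forall n, 0 <= M n <= (INR n + 1) * (2 * INR n + 1) * T n)%R -> ex_series M).
  { intros M HM. apply (ex_series_le (V := R_CompleteNormedModule) M (fun n => (INR n + 1) * (2 * INR n + 1) * T n)%R).
    - intros n. change (norm (M n)) with (Rabs (M n)). rewrite Rabs_pos_eq; apply HM.
    - now exists s. }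
  assert (Habs : abs_conv a).
  { intros r Hr. apply ex_series_incr_1. apply Hex. intros n.
    pose proof (HT n). pose proof (pos_INR n). pose proof (Cmod_ge_0 (a (S n))).
    assert (Hrn : (0 <= r ^ S n <= 1)%R).
    { split; [apply pow_le; lra|]. rewrite <- (pow1 (S n)). apply pow_incr. lra. }
    split; [apply Rmult_le_pos; lra|].
    apply Rle_trans with (Cmod (a (S n)) * 1)%R; [apply Rmult_le_compat_l; lra|].
    rewrite Rmult_1_r. apply (Rle_trans _ _ _ (HaT n)).
    assert (0 <= INR n * T n)%R by (apply Rmult_le_pos; lra).
    assert (0 <= INR n * INR n * T n)%R by (apply Rmult_le_pos; [apply Rmult_le_pos|]; lra). lra. }
  assert (Hfc : forall z, unit_disc z -> f z = cps a z).
  { intros z Hz. symmetry. apply CSeries_unique. apply is_pseries_C. now apply Hf. }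
  split.
  { split; [now apply analytic_on_cps with a|]. exists a. auto. }
  (* Majorants for the coefficients of [f'] and, after a shift by one index, of [f'']; the
     hypothesis is exactly [2 M2 + M1] summed. *)
  set (M1 := fun n => ((INR n + 1) * T n)%R). set (M2 := fun n => (INR n * (INR n + 1) * T n)%R).
  assert (E1 : ex_series M1).
  { apply Hex. intros n. unfold M1. pose proof (HT n). pose proof (pos_INR n).
    assert (0 <= INR n * T n)%R by (apply Rmult_le_pos; lra).
    assert (0 <= INR n * INR n * T n)%R by (apply Rmult_le_pos; [apply Rmult_le_pos|]; lra). lra. }
  assert (HM2 : forall n, (0 <= M2 n)%R).
  { intros n. unfold M2. pose proof (HT n). pose proof (pos_INR n).
    apply Rmult_le_pos; [apply Rmult_le_pos|]; lra. }
  assert (E2 : ex_series M2).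
  { apply Hex. intros n. split; [apply HM2|]. unfold M2. pose proof (HT n). pose proof (pos_INR n).
    assert (0 <= INR n * T n)%R by (apply Rmult_le_pos; lra).
    assert (0 <= INR n * INR n * T n)%R by (apply Rmult_le_pos; [apply Rmult_le_pos|]; lra). lra. }
  assert (Hsum : (2 * Series M2 + Series M1 <= 2)%R).
  { rewrite <- Series_scal_l, <- Series_plus; auto.
    2:{ now apply (ex_series_scal_l (K := R_AbsRing) (V := R_NormedModule)). }
    replace (Series (fun n => 2 * M2 n + M1 n)%R) with s; [easy|].
    symmetry. apply is_series_unique. revert Hs. apply is_series_ext. intros n. unfold M1, M2.
    match goal with |- @eq _ ?x ?y => change (@eq R x y) end. ring. }
  assert (HM20 : M2 0%nat = 0%R) by (unfold M2; simpl; ring).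
  assert (HS2 : is_series (fun n => M2 (S n)) (Series M2)).
  { rewrite (Series_incr_1 _ E2), HM20, Rplus_0_l. apply Series_correct.
    now apply (ex_series_incr_1 M2). }
  (* Strict positivity carries the strict inequality [|z - zeta| < 2] through the product, which the
     non-strict bound [s <= 2] could not supply. *)
  assert (HS2pos : (0 < Series M2)%R).
  { apply Rlt_le_trans with (M2 1%nat).
    - unfold M2. pose proof (HT 1%nat). simpl. lra.
    - apply Rle_trans with (sum_n (fun n => M2 (S n)) 0); [rewrite sum_O; lra|].
      apply (is_lim_seq_incr_compare (sum_n (fun n => M2 (S n)))); [exact HS2|].
      intros n. rewrite sum_Sn. match goal with |- (?x <= plus _ ?y)%R => change (x <= x + y)%R end. specialize (HM2 (S (S n))). lra. }
  assert (Hd1 : abs_conv (cder a)) by now apply abs_conv_cder.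
  assert (HC1 : forall z, unit_disc z -> C_derive f z = cps (cder a) z).
  { intros z Hz. now apply C_derive_cps. }
  intros z zeta Hz Hzeta.
  rewrite (C_derive_cps (C_derive f) (cder a) z Hd1 HC1 Hz), (HC1 z Hz).
  unfold unit_disc in Hz, Hzeta.
  assert (Hpow : forall n, (0 <= Cmod (z ^ n) <= 1)%R).
  { intros n. rewrite Cmod_pow. pose proof (Cmod_ge_0 z). split; [apply pow_le; lra|].
    rewrite <- (pow1 n). apply pow_incr. lra. }
  (* The constant term of [f'] is 1 and [M1 0 = 1], so [|f' - 1| <= Series M1 - 1]. *)
  assert (HB1 : (2 - Series M1 <= Cmod (cps (cder a) z))%R).
  { pose proof (is_series_tail_norm (V := C_NormedModule) _ _ M1 (Series M1) 0 (cps_spec _ _ Hd1 Hz)) as Ht.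
    rewrite !sum_O in Ht.
    assert (H1 : (Cmod (cps (cder a) z - 1) <= Series M1 - M1 0%nat)%R).
    { replace (cps (cder a) z - 1) with (minus (cps (cder a) z) (cder a 0 * z ^ 0)).
      - apply Ht; [|now apply Series_correct].
        intros n. match goal with |- (norm ?X <= ?B)%R => change (Cmod X <= B)%R end.
        rewrite Cmod_mult, Cmod_cder. unfold M1. rewrite S_INR. specialize (HaT n). specialize (Hpow n).
        pose proof (pos_INR n). pose proof (Cmod_ge_0 (a (S n))).
        rewrite <- (Rmult_1_r ((INR n + 1) * T n)).
        apply Rmult_le_compat; try lra. apply Rmult_le_pos; lra. apply Rmult_le_compat_l; lra.
      - unfold cder. rewrite Ha1. unfold minus, plus, opp; cbn -[cps]. as_C. ring. }
    assert (HM10 : M1 0%nat = 1%R) by (unfold M1; rewrite HT0; simpl; ring).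
    assert (H2 : (1 <= Cmod (cps (cder a) z) + Cmod (cps (cder a) z - 1))%R).
    { rewrite <- (Cmod_opp (cps (cder a) z - 1)), <- Cmod_1 at 1.
      replace (RtoC 1) with (cps (cder a) z + - (cps (cder a) z - 1)) at 1 by ring. apply Cmod_triangle. }
    lra. }
  assert (HB2 : (Cmod (cps (cder (cder a)) z) <= Series M2)%R).
  { apply (is_series_norm_le (V := C_NormedModule) _ _ (fun n => M2 (S n)) _ (cps_spec _ _ (abs_conv_cder _ Hd1) Hz)); [|exact HS2].
    intros n. match goal with |- (norm ?X <= ?B)%R => change (Cmod X <= B)%R end.
    rewrite Cmod_mult, !Cmod_cder. unfold M2. rewrite (S_INR (S n)). specialize (HaT (S n)). specialize (Hpow n).
    pose proof (pos_INR (S n)). pose proof (Cmod_ge_0 (a (S (S n)))).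
    rewrite <- (Rmult_1_r (INR (S n) * (INR (S n) + 1) * T (S n))), <- Rmult_assoc.
    apply Rmult_le_compat; try lra.
    - repeat apply Rmult_le_pos; lra.
    - apply Rmult_le_compat_l; [|lra]. apply Rmult_le_pos; lra. }
  assert (Hzz : (Cmod (z - zeta) < 2)%R).
  { eapply Rle_lt_trans; [apply Cmod_triangle|]. rewrite Cmod_opp. lra. }
  assert (Hlt : (Cmod ((z - zeta) * cps (cder (cder a)) z) < Cmod (cps (cder a) z))%R).
  { rewrite Cmod_mult. apply Rle_lt_trans with (Cmod (z - zeta) * Series M2)%R.
    - apply Rmult_le_compat_l; [apply Cmod_ge_0 | easy].
    - assert (Cmod (z - zeta) * Series M2 < 2 * Series M2)%R by (apply Rmult_lt_compat_r; lra). lra. }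
  assert (Hne : cps (cder a) z <> 0).
  { intros H0. rewrite H0, Cmod_0 in Hlt.
    pose proof (Cmod_ge_0 ((z - zeta) * cps (cder (cder a)) z)). lra. }
  split; [easy|]. apply Re_1_plus_pos. rewrite Cmod_div by easy.
  apply Cmod_gt_0 in Hne.
  apply Rmult_lt_reg_r with (Cmod (cps (cder a) z)); [easy|].
  unfold Rdiv. rewrite Rmult_assoc, Rinv_l, Rmult_1_r, Rmult_1_l; lra.
Qed.

(** * Coefficients of the 3F2 series and conclusion *)

Lemma pochhammer_double (x : C) (n : nat) :
  pochhammer x (2 * n) = RtoC 4 ^ n * (pochhammer (x / 2) n * pochhammer ((x + 1) / 2) n).
Proof.
  induction n as [|n IH]; [simpl; ring|].
  replace (2 * S n)%nat with (S (S (2 * n))) by lia.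
  cbn [pochhammer Cpow]. rewrite IH, S_INR, mult_INR, !RtoC_plus, RtoC_mult.
  simpl (INR 2). rewrite RtoC_plus.
  replace (RtoC 4) with ((1 + 1) * (1 + 1)) by (rewrite <- RtoC_plus, <- RtoC_mult; f_equal; lra).
  replace (RtoC 2) with (1 + 1) by (rewrite <- RtoC_plus; f_equal; lra).
  field.
Qed.

Lemma Cmod_pochhammer_le (x : C) (n : nat) : (Cmod (pochhammer x n) <= rpoch (Cmod x) n)%R.
Proof.
  induction n as [|n IH]; simpl.
  - rewrite Cmod_1. lra.
  - rewrite Cmod_mult. apply Rmult_le_compat; auto using Cmod_ge_0.
    eapply Rle_trans; [apply Cmod_triangle|]. rewrite Cmod_R, (Rabs_pos_eq (INR n)); auto using pos_INR. lra.
Qed.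

Definition clausen_coef (a b : C) (c : R) (n : nat) : C :=
  pochhammer a n * pochhammer (b / 2) n * pochhammer ((b + 1) / 2) n
  / (pochhammer (c / 2) n * pochhammer ((c + 1) / 2) n * pochhammer 1 n).

(** Duplication applied to both [b] and [c] makes the powers of 4 cancel. The denominator is then
    real and positive, and only the numerator needs the triangle inequality. *)
Lemma Cmod_clausen_coef_le (a b : C) (c : R) (n : nat) : (0 < c)%R ->
  (Cmod (clausen_coef a b c n) <= clausen_term (Cmod a) (Cmod b) c n)%R.
Proof.
  intros Hc.
  pose proof (rpoch_pos c (2 * n) Hc) as H1. pose proof (rpoch_pos 1 n Rlt_0_1) as H2.
  assert (Hq : RtoC 4 ^ n <> 0).
  { rewrite <- RtoC_pow. intros H. apply RtoC_inj in H. apply (pow_nonzero 4 n); lra. }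
  pose proof (pochhammer_double c n) as Hcd. rewrite RtoC_rpoch in Hcd.
  set (d := pochhammer (c / 2) n * pochhammer ((c + 1) / 2) n) in *.
  assert (Hd : d <> 0).
  { intros H. rewrite H, Cmult_0_r in Hcd. apply RtoC_inj in Hcd. lra. }
  assert (Hp1 : RtoC (rpoch 1 n) <> 0) by (intros H; apply RtoC_inj in H; lra).
  replace (clausen_coef a b c n) with
    (pochhammer a n * pochhammer b (2 * n) / RtoC (rpoch c (2 * n) * rpoch 1 n)).
  2:{ unfold clausen_coef. fold d. rewrite RtoC_mult, Hcd, pochhammer_double, (RtoC_rpoch 1).
      field. auto. }
  assert (Hpos : (0 < rpoch c (2 * n) * rpoch 1 n)%R) by now apply Rmult_lt_0_compat.
  rewrite Cmod_div, !Cmod_mult, Cmod_R, Rabs_pos_eq by (try (intros H; apply RtoC_inj in H); lra).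
  unfold clausen_term. apply Rmult_le_compat_r; [left; now apply Rinv_0_lt_compat|].
  apply Rmult_le_compat; auto using Cmod_ge_0, Cmod_pochhammer_le.
Qed.

Theorem theorem4p1 (a b : C) (c : R) (F0 F1 F2 : C -> C)
  (ha : a <> 0) (hb : b <> 0) (hc : (0 < c)%R)
  (hcab : (c > Cmod a + Cmod b + 2)%R)
  (hF0 : is_hyp2F1 (Cmod a) (Cmod b) (c - Cmod a) F0)
  (hF1 : is_hyp2F1 (Cmod a + 1) (Cmod b + 2) (c - Cmod a + 1) F1)
  (hF2 : is_hyp2F1 (Cmod a + 2) (Cmod b + 4) (c - Cmod a + 2) F2)
  (* The expression is real, since all parameters and the point -1 are. *)
  (hle : (Re (
     RtoC (Gamma c * Gamma (c - Cmod a - Cmod b)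
           / (Gamma (c - Cmod a) * Gamma (c - Cmod b)))%R
     * (2 * pochhammer (Cmod a) 2 * pochhammer (Cmod b) 4
          / (pochhammer (c - Cmod a) 2 * pochhammer (c - Cmod a - Cmod b - 2) 2)
          * F2 (-1)
        + 5 * Cmod a * pochhammer (Cmod b) 2
          / ((c - Cmod a) * (c - Cmod a - Cmod b - 1))
          * F1 (-1)
        + F0 (-1))) <= 2)%R) :
  UCV (fun z => z * hyp3F2 a (b / 2) ((b + 1) / 2) (c / 2) ((c + 1) / 2) z).
Proof.
  apply Cmod_gt_0 in ha. apply Cmod_gt_0 in hb.
  set (A := Cmod a) in *. set (B := Cmod b) in *.
  rewrite <- RtoC_minus in hF0.
  rewrite <- RtoC_minus, <- !RtoC_plus in hF1.
  rewrite <- RtoC_minus, <- !RtoC_plus in hF2.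
  (* The third parameters take the form [c' - A'] for the triples [(A+1, B+2, c+2)] and
     [(A+2, B+4, c+4)], as [clausen_sum_hyp2F1] expects. *)
  replace (c - A + 1)%R with (c + 2 - (A + 1))%R in hF1 by ring.
  replace (c - A + 2)%R with (c + 4 - (A + 2))%R in hF2 by ring.
  apply clausen_sum_hyp2F1 in hF0, hF1, hF2; try lra.
  pose proof (clausen_weighted_sum A B c _ _ _ ha hb ltac:(lra) hF0 hF1 hF2) as HS.
  rewrite <- !RtoC_minus, !RtoC_rpoch, <- !RtoC_mult, <- !RtoC_div in hle.
  2:{ apply Rgt_not_eq. apply Rmult_lt_0_compat; lra. }
  2:{ apply Rgt_not_eq. apply Rmult_lt_0_compat; apply rpoch_pos; lra. }
  fold (gamma_factor A B c) in hle.
  assert (HRe : forall k x2 x1 (u2 u1 u0 : C),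
    Re (RtoC k * (RtoC x2 * u2 + RtoC x1 * u1 + u0)) = (k * (x2 * Re u2 + x1 * Re u1 + Re u0))%R).
  { intros k x2 x1 [p2 q2] [p1 q1] [p0 q0]. simpl. ring. }
  rewrite HRe in hle.
  assert (Hcoef : forall n, (Cmod (clausen_coef a b c n) <= clausen_term A B c n)%R).
  { intros n. now apply Cmod_clausen_coef_le. }
  (* The factor [z] in front of the 3F2 shifts its coefficients by one index. *)
  apply UCV_of_coefficients with (a := fun n => match n with O => RtoC 0 | S m => clausen_coef a b c m end)
    (T := clausen_term A B c) (5 := Hcoef) (6 := HS).
  - reflexivity.
  - unfold clausen_coef. simpl. field.
  - intros n. now apply clausen_term_pos.
  - unfold clausen_term. simpl. field.
  - exact hle.
  - intros z Hz. apply is_pseries_C.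
    apply is_series_decr_1.
    assert (Hs : is_series (fun n => clausen_coef a b c n * z ^ n)
       (hyp3F2 a (b / 2) ((b + 1) / 2) (c / 2) ((c + 1) / 2) z)).
    { apply CSeries_correct. apply ex_CSeries_le with (clausen_term A B c); [|eexists; exact hF0].
      intros n. change (Cmod (clausen_coef a b c n * z ^ n) <= clausen_term A B c n)%R.
      rewrite Cmod_mult, Cmod_pow. rewrite <- (Rmult_1_r (clausen_term A B c n)).
      pose proof (Cmod_ge_0 z). unfold unit_disc in Hz.
      apply Rmult_le_compat; auto using Cmod_ge_0. apply pow_le; lra.
      rewrite <- (pow1 n). apply pow_incr. lra. }
    apply (is_series_scal (V := C_NormedModule) z) in Hs.
    replace (plus _ _) with (scal z (hyp3F2 a (b / 2) ((b + 1) / 2) (c / 2) ((c + 1) / 2) z)).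
    + revert Hs. apply is_series_ext. intros n. unfold scal; cbn -[clausen_coef]. as_C. ring.
    + unfold plus, opp, scal; cbn -[hyp3F2]. as_C. ring.
Qed.
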